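(* Let $\bar x\in\Phi$ be a local second-order weak sharp minimizer of problem (P) with corresponding constants $\kappa>0$ and $\delta>0$. Suppose that DirRCQ holds at every $x\in\Phi\cap B_\delta(\bar x)$ in every direction $d\in C(x)$. Then for any $\varepsilon\in[0,1/2)$, $x\in S\cap B_\delta(\bar x)$ and $d\in C(x)\cap N^{P,\varepsilon}_S(x)$: (i) for every $v\in T''_K(g(x);\nabla g(x)d)$ there exists $\lambda_v\in\Lambda^c(x;d)$ with $\langle\lambda_v,v\rangle\le0$; (ii) for every $w\in T^2_K(g(x);\nabla g(x)d)$ there exists $\lambda_w\in\Lambda^c(x;d)$ with $\nabla^2_{xx}L(x,\lambda_w)(d,d)-\langle\lambda_w,w\rangle\ge2\kappa(1-2\varepsilon)^2\|d\|^2$. Moreover, for every $x\in S\cap B_\delta(\bar x)$ and every $d\in C(x)$, (i) holds and (ii) holds with the right-hand side replaced by $2\kappa[\mathrm{dist}(d,T_S(x))]^2$.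
   Context: Standing setting: $f:\mathbb{R}^n\to\mathbb{R}$, $g:\mathbb{R}^n\to\mathbb{R}^m$ twice continuously differentiable, $K\subset\mathbb{R}^m$ closed; (P) is $\min f(x)$ s.t. $g(x)\in K$; $\Phi:=\{x:g(x)\in K\}$; $S$ is the (nonempty) set of optimal solutions; $L(x,\lambda):=f(x)+\langle g(x),\lambda\rangle$. $\bar x\in\Phi$ is a local second-order weak sharp minimizer with constants $\kappa,\delta>0$ if $f(x)\ge f(\bar x)+\kappa[\mathrm{dist}(x,S)]^2$ for all $x\in\Phi\cap B_\delta(\bar x)$. For a closed set $A$ and $\bar x\in A$: $T_A(\bar x):=\{d:\exists t_k\downarrow0,d_k\to d,\bar x+t_kd_k\in A\}$; for $d\in T_A(\bar x)$, $T^2_A(\bar x;d):=\{w:\exists t_k\downarrow0,w_k\to w,\bar x+t_kd+\tfrac12t_k^2w_k\in A\}$, $T''_A(\bar x;d):=\{w:\exists(t_k,r_k)\downarrow(0,0),t_k/r_k\to0,w_k\to w,\bar x+t_kd+\tfrac12t_kr_kw_k\in A\}$. $C(x):=\{d:\nabla g(x)d\in T_K(g(x)),\nabla f(x)d\le0\}$. $N^P_A(\bar x):=\{v:\exists\tau>0,\ \bar x\text{ is a nearest point of }A\text{ to }\bar x+\tau v\}$; $N^{P,\varepsilon}_A(\bar x):=\{v:\mathrm{dist}(v,N^P_A(\bar x))\le\varepsilon\|v\|\}$. Fréchet normal cone $\hat N_A(y):=\{v:\limsup_{y'\to y,y'\in A}\langle v,y'-y\rangle/\|y'-y\|\le0\}$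 (empty if $y\notin A$); directional limiting normal cone $N_A(\bar y;u):=\{v:\exists t_k\downarrow0,u_k\to u,v_k\to v,\ v_k\in\hat N_A(\bar y+t_ku_k)\}$; directional Clarke normal cone $N^c_A(\bar y;u):=\mathrm{cl}\,\mathrm{co}\,N_A(\bar y;u)$. Directional C-multiplier set: $\Lambda^c(x;d):=\{\lambda:\nabla_xL(x,\lambda)=0,\ \lambda\in N^c_K(g(x);\nabla g(x)d)\}$. DirRCQ holds at $x$ in direction $d$ if $\nabla g(x)^T\lambda=0,\ \lambda\in N^c_K(g(x);\nabla g(x)d)$ imply $\lambda=0$. $\nabla^2g(x)(d,d):=(d^T\nabla^2g_i(x)d)_{i=1}^m$. *)

(* Defs.v *)
From HB Require Import structures.
From mathcomp Require Import all_boot all_order all_algebra.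
From mathcomp Require Import all_classical all_reals all_analysis.
Set Implicit Arguments. Unset Strict Implicit. Unset Printing Implicit Defensive.
Import Order.TTheory GRing.Theory Num.Theory.
Import numFieldNormedType.Exports.
Local Open Scope classical_set_scope.
Local Open Scope ring_scope.

Section Defs.
Variable R : realType.

(* Euclidean inner product and norm on R^k (the library norm on 'rV is the sup norm). *)
Definition dotv (k : nat) (u v : 'rV[R]_k) : R := \sum_(i < k) u 0 i * v 0 i.
Definition eunorm (k : nat) (u : 'rV[R]_k) : R := Num.sqrt (dotv u u).

Definition setdist (k : nat) (x : 'rV[R]_k) (A : set 'rV[R]_k) : R :=
  inf [set eunorm (x - a) | a in A].

Definition eball (k : nat) (c : 'rV[R]_k) (r : R) : set 'rV[R]_k :=
  [set x | eunorm (x - c) < r].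

Definition C2 (k l : nat) (f : 'rV[R]_k -> 'rV[R]_l) : Prop :=
  (forall x, differentiable f x) /\
  (forall v x, differentiable (fun y => 'd f y v) x) /\
  (forall u v, continuous (fun y => 'd (fun z => 'd f z v) y u)).

Definition grad (k l : nat) (f : 'rV[R]_k -> 'rV[R]_l) (x d : 'rV[R]_k) : 'rV[R]_l :=
  'd f x d.
Definition hess2 (k l : nat) (f : 'rV[R]_k -> 'rV[R]_l) (x d : 'rV[R]_k) : 'rV[R]_l :=
  'd (fun y => 'd f y d) x d.

Definition down0 (t : nat -> R) : Prop := (forall k, 0 < t k) /\ t @ \oo --> 0.

Definition Tcone (k : nat) (A : set 'rV[R]_k) (x : 'rV[R]_k) : set 'rV[R]_k :=
  [set d | exists (t : nat -> R) (dk : nat -> 'rV[R]_k),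
      down0 t /\ dk @ \oo --> d /\ forall j, A (x + t j *: dk j)].

Definition T2set (k : nat) (A : set 'rV[R]_k) (x d : 'rV[R]_k) : set 'rV[R]_k :=
  [set w | exists (t : nat -> R) (wk : nat -> 'rV[R]_k),
      down0 t /\ wk @ \oo --> w /\
      forall j, A (x + t j *: d + (2^-1 * t j ^+ 2) *: wk j)].

Definition T2asym (k : nat) (A : set 'rV[R]_k) (x d : 'rV[R]_k) : set 'rV[R]_k :=
  [set w | exists (t r : nat -> R) (wk : nat -> 'rV[R]_k),
      down0 t /\ down0 r /\ (fun j => t j / r j) @ \oo --> 0 /\
      wk @ \oo --> w /\
      forall j, A (x + t j *: d + (2^-1 * t j * r j) *: wk j)].

Definition NPcone (k : nat) (A : set 'rV[R]_k) (x : 'rV[R]_k) : set 'rV[R]_k :=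
  [set v | A x /\ exists tau : R, 0 < tau /\
      forall a, A a -> eunorm (x + tau *: v - x) <= eunorm (x + tau *: v - a)].

Definition NPeps (k : nat) (A : set 'rV[R]_k) (x : 'rV[R]_k) (eps : R) : set 'rV[R]_k :=
  [set v | setdist v (NPcone A x) <= eps * eunorm v].

(* Frechet (regular) normal cone; empty outside A. The condition
   limsup_{y'->y, y' in A} <v, y'-y>/||y'-y|| <= 0 is written out. *)
Definition Fnormal (k : nat) (A : set 'rV[R]_k) (y : 'rV[R]_k) : set 'rV[R]_k :=
  [set v | A y /\ forall e : R, 0 < e -> exists r : R, 0 < r /\
      forall y', A y' -> eunorm (y' - y) < r -> dotv v (y' - y) <= e * eunorm (y' - y)].

Definition Ndir (k : nat) (A : set 'rV[R]_k) (y u : 'rV[R]_k) : set 'rV[R]_k :=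
  [set v | exists (t : nat -> R) (uk vk : nat -> 'rV[R]_k),
      down0 t /\ uk @ \oo --> u /\ vk @ \oo --> v /\
      forall j, Fnormal A (y + t j *: uk j) (vk j)].

Definition convhull (k : nat) (A : set 'rV[R]_k) : set 'rV[R]_k :=
  [set x | exists (p : nat) (a : 'I_p -> 'rV[R]_k) (l : 'I_p -> R),
      (forall i, A (a i)) /\ (forall i, 0 <= l i) /\ \sum_(i < p) l i = 1 /\
      x = \sum_(i < p) l i *: a i].

Definition NCdir (k : nat) (A : set 'rV[R]_k) (y u : 'rV[R]_k) : set 'rV[R]_k :=
  closure (convhull (Ndir A y u)).

Variables (n m : nat) (f : 'rV[R]_n -> 'rV[R]_1) (g : 'rV[R]_n -> 'rV[R]_m)
  (K : set 'rV[R]_m).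

Definition fval (x : 'rV[R]_n) : R := f x 0 0.

Definition Phi : set 'rV[R]_n := [set x | K (g x)].
Definition Sol : set 'rV[R]_n :=
  [set x | Phi x /\ forall y, Phi y -> fval x <= fval y].

Definition local_sowsm (xbar : 'rV[R]_n) (kappa delta : R) : Prop :=
  Phi xbar /\ forall x, Phi x -> eball xbar delta x ->
    fval x >= fval xbar + kappa * (setdist x Sol) ^+ 2.

Definition Ccone (x : 'rV[R]_n) : set 'rV[R]_n :=
  [set d | Tcone K (g x) (grad g x d) /\ grad f x d 0 0 <= 0].

(* directional C-multiplier set Lambda^c(x; d):
   nabla_x L(x,lam) = 0 (as a linear functional) and lam in N^c_K(g(x); nabla g(x) d) *)
Definition Lambdac (x d : 'rV[R]_n) : set 'rV[R]_m :=
  [set lam | (forall h, grad f x h 0 0 + dotv lam (grad g x h) = 0) /\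
             NCdir K (g x) (grad g x d) lam].

Definition DirRCQ (x d : 'rV[R]_n) : Prop :=
  forall lam, NCdir K (g x) (grad g x d) lam ->
    (forall h, dotv lam (grad g x h) = 0) -> lam = 0.

Definition hessL (x : 'rV[R]_n) (lam : 'rV[R]_m) (d : 'rV[R]_n) : R :=
  hess2 f x d 0 0 + dotv lam (hess2 g x d).

Definition prop_i (x d : 'rV[R]_n) : Prop :=
  forall v, T2asym K (g x) (grad g x d) v ->
    exists lam, Lambdac x d lam /\ dotv lam v <= 0.

Definition prop_ii (x d : 'rV[R]_n) (rhs : R) : Prop :=
  forall w, T2set K (g x) (grad g x d) w ->
    exists lam, Lambdac x d lam /\ hessL x lam d - dotv lam w >= rhs.

End Defs.

(* Main.v *)
Require Import Defs.
From HB Require Import structures.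
From mathcomp Require Import all_boot all_order all_algebra.
From mathcomp Require Import all_classical all_reals all_analysis.
From mathcomp Require Import ring lra.
Import Order.TTheory GRing.Theory Num.Theory.
Import numFieldNormedType.Exports.
Local Open Scope classical_set_scope.
Local Open Scope ring_scope.

Set Implicit Arguments.
Unset Strict Implicit.
Unset Printing Implicit Defensive.

(** The closed convex cone [N = NCdir K (g x) (grad g x d)] meets the kernel of the
    adjoint of the Jacobian only at 0, so conic linear duality holds without a gap:
    either the required multiplier exists, or there is a [z] such that
    [grad g x z + hess2 g x d - w] lies in the polar of [N] and the second-order
    expansion of the objective along [x + t d + t^2/2 z] is too small.
    Polarity to the directional limiting normals makes the polar of [N] a set of
    directional Clarke tangents: moving a point of [K] close to [g x + t grad g x d]
    along such a direction stays in [K] up to a small relative error.  DirRCQ gives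
    metric subregularity of [g] in direction [d], which corrects
    [x + t d + t^2/2 z] to a feasible point.  Its growth inequality, divided by
    [t^2/2], contradicts the choice of [z], because the limit points of
    [(S - x) / t] are tangent to [S].  The first assertion uses the same arcs with
    step [t r / 2] and mere optimality of [x].  Finally, a proximal normal has
    nonpositive product with every tangent, so
    [dist (d, T_S(x)) >= (1 - 2 eps) |d|] when [d] is an [eps]-proximal normal. *)

(** * Euclidean geometry *)

Ltac vec := apply/rowP => ?; rewrite !mxE; ring.

Section Euclid.
Variables (R : realType) (k : nat).
Implicit Types (u v w x y z : 'rV[R]_k) (e : R).

Lemma dotvC u v : dotv u v = dotv v u.
Proof. by apply: eq_bigr => i _; rewrite mulrC. Qed.

Lemma dotvDl u v w : dotv (u + v) w = dotv u w + dotv v w.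
Proof. by rewrite -big_split; apply: eq_bigr => i _; rewrite mxE mulrDl. Qed.

Lemma dotvZl a u v : dotv (a *: u) v = a * dotv u v.
Proof. by rewrite mulr_sumr; apply: eq_bigr => i _; rewrite mxE mulrA. Qed.

Lemma dotvDr u v w : dotv w (u + v) = dotv w u + dotv w v.
Proof. by rewrite dotvC dotvDl !(dotvC w). Qed.

Lemma dotvZr a u v : dotv u (a *: v) = a * dotv u v.
Proof. by rewrite dotvC dotvZl dotvC. Qed.

Lemma dotvNl u v : dotv (- u) v = - dotv u v.
Proof. by rewrite -scaleN1r dotvZl mulN1r. Qed.

Lemma dotvNr u v : dotv u (- v) = - dotv u v.
Proof. by rewrite dotvC dotvNl dotvC. Qed.

Lemma dotv0l v : dotv 0 v = 0.
Proof. by rewrite -(scale0r 0) dotvZl mul0r. Qed.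

Lemma dotv0r v : dotv v 0 = 0.
Proof. by rewrite dotvC dotv0l. Qed.

Definition dotvE := (dotvDl, dotvDr, dotvZl, dotvZr, dotvNl, dotvNr, dotv0l, dotv0r).

Lemma dotvv_ge0 u : 0 <= dotv u u.
Proof. by apply: sumr_ge0 => i _; rewrite -expr2 sqr_ge0. Qed.

Lemma eunorm_ge0 u : 0 <= eunorm u.
Proof. exact: sqrtr_ge0. Qed.

Lemma sqr_eunorm u : eunorm u ^+ 2 = dotv u u.
Proof. by rewrite sqr_sqrtr // dotvv_ge0. Qed.

Lemma dotvv_eq0 u : dotv u u = 0 -> u = 0.
Proof.
move=> /eqP; rewrite psumr_eq0; last by move=> i _; rewrite -expr2 sqr_ge0.
move=> /allP h; apply/rowP => i; rewrite mxE; apply/eqP.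
by have := h i (mem_index_enum i); rewrite /= mulf_eq0 orbb.
Qed.

Lemma eunorm_eq0 u : eunorm u = 0 -> u = 0.
Proof. by move=> h; apply: dotvv_eq0; rewrite -sqr_eunorm h expr0n. Qed.

Lemma eunorm0 : eunorm (0 : 'rV[R]_k) = 0.
Proof. by rewrite /eunorm dotv0l sqrtr0. Qed.

Lemma eunorm_gt0 u : u != 0 -> 0 < eunorm u.
Proof.
move=> u0; rewrite lt_neqAle eunorm_ge0 andbT eq_sym.
by apply: contra u0 => /eqP /eunorm_eq0 ->.
Qed.

Lemma eunormZ a u : eunorm (a *: u) = `|a| * eunorm u.
Proof.
rewrite /eunorm dotvZl dotvZr mulrA -expr2 sqrtrM ?sqr_ge0 //.
by rewrite sqrtr_sqr.
Qed.

Lemma eunormN u : eunorm (- u) = eunorm u.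
Proof. by rewrite -scaleN1r eunormZ normrN1 mul1r. Qed.

Lemma eunormB u v : eunorm (u - v) = eunorm (v - u).
Proof. by rewrite -eunormN opprB. Qed.

Lemma ler_of_sqr (a b : R) : 0 <= b -> a ^+ 2 <= b ^+ 2 -> a <= b.
Proof.
move=> b0 h; have [a0|a0] := leP 0 a; first by rewrite -(@ler_sqr R).
by rewrite (le_trans (ltW a0)).
Qed.

Lemma dotv_le u v : dotv u v <= eunorm u * eunorm v.
Proof.
apply: ler_of_sqr; first by rewrite mulr_ge0 ?eunorm_ge0.
rewrite exprMn !sqr_eunorm.
have [/dotvv_eq0 ->|v0] := eqVneq (dotv v v) 0.
  by rewrite !dotvE mulr0 expr0n.
have vp : 0 < dotv v v by rewrite lt_neqAle eq_sym v0 dotvv_ge0.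
have := dotvv_ge0 (dotv v v *: u - dotv u v *: v).
rewrite !dotvE (dotvC v u) => h.
have {h} : 0 <= dotv v v * (dotv u u * dotv v v - dotv u v ^+ 2) by lra.
by rewrite pmulr_rge0 // subr_ge0.
Qed.

Lemma dotv_abs_le u v : `|dotv u v| <= eunorm u * eunorm v.
Proof.
rewrite ler_norml dotv_le andbT lerNl -dotvNl.
by rewrite -(eunormN u) dotv_le.
Qed.

Lemma eunormD u v : eunorm (u + v) <= eunorm u + eunorm v.
Proof.
apply: ler_of_sqr; first by rewrite addr_ge0 ?eunorm_ge0.
have := dotv_le u v; rewrite sqrrD !sqr_eunorm !dotvE (dotvC v u).
lra.
Qed.

Lemma eunorm_tri x y z : eunorm (x - z) <= eunorm (x - y) + eunorm (y - z).
Proof. by apply: le_trans (eunormD _ _); rewrite addrA subrK. Qed.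

Lemma coord_le_eunorm u i : `|u 0 i| <= eunorm u.
Proof.
apply: ler_of_sqr; first exact: eunorm_ge0.
rewrite real_normK ?num_real // sqr_eunorm /dotv (bigD1 i) //= -expr2 lerDl.
by apply: sumr_ge0 => j _; rewrite -expr2 sqr_ge0.
Qed.

Lemma eunorm_le_coord u e : 0 <= e -> (forall i, `|u 0 i| <= e) ->
  eunorm u <= k%:R * e.
Proof.
move=> e0 h; apply: ler_of_sqr; first by rewrite mulr_ge0.
rewrite sqr_eunorm exprMn; apply: (@le_trans _ _ (k%:R * e ^+ 2)).
  rewrite -[X in X%:R]card_ord mulr_natl -sumr_const; apply: ler_sum => i _.
  by rewrite -expr2 -[u 0 i ^+ 2]real_normK ?num_real // lerXn2r ?nnegrE.
apply: ler_wpM2r; first exact: sqr_ge0.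
by rewrite -natrX ler_nat -mulnn; case: (k) => // j; rewrite leq_pmulr.
Qed.

Lemma eunorm_le_norm u : eunorm u <= k%:R * `|u|.
Proof.
apply: eunorm_le_coord => // i.
rewrite [leRHS]/Num.Def.normr /= mx_normrE; apply/bigmax_geP; right => /=.
by exists (0, i).
Qed.

Lemma norm_le_eunorm u : `|u| <= eunorm u.
Proof.
rewrite [leLHS]/Num.Def.normr /= mx_normrE; apply: bigmax_le; first exact: eunorm_ge0.
by move=> [j i] _ /=; rewrite ord1 coord_le_eunorm.
Qed.

(** The topology on row vectors comes from the sup norm. Each norm bounds the other up to a factor
    depending on [k], so every later limit can be argued in [eunorm]. *)
Lemma nbhs_eunorm x (A : set 'rV[R]_k) :
  nbhs x A <-> exists2 e, 0 < e & forall y, eunorm (y - x) < e -> A y.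
Proof.
split.
- move=> /nbhs_ballP[e /= e0 h]; exists e => // y xy; apply: h.
  rewrite mx_norm_ball /ball_ /= distrC.
  exact: le_lt_trans (norm_le_eunorm _) xy.
- move=> [e e0 h]; apply/nbhs_ballP.
  (* Adding 1 keeps the divisor positive in dimension 0. *)
  have k1 : 0 < k%:R + 1 :> R by rewrite ltr_wpDl.
  exists (e / (k%:R + 1)); first by rewrite /= divr_gt0.
  move=> y; rewrite mx_norm_ball /ball_ /= distrC ltr_pdivlMr // => xy; apply: h.
  apply: le_lt_trans (eunorm_le_norm _) _; apply: le_lt_trans xy.
  rewrite mulrC; apply: ler_wpM2l => //; lra.
Qed.

Lemma cvg_eunorm (xs : nat -> 'rV[R]_k) x : xs @ \oo --> x <->
  forall e, 0 < e -> exists N, forall j, (N <= j)%N -> eunorm (xs j - x) < e.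
Proof.
split=> [h e e0|h A /nbhs_eunorm[e e0 hA]].
  have : nbhs x [set y | eunorm (y - x) < e] by apply/nbhs_eunorm; exists e.
  by move=> /h [N _ hN]; exists N => j Nj; exact: hN.
by have [N hN] := h e e0; exists N => // j Nj; apply: hA; exact: hN.
Qed.

Lemma closure_eunorm (A : set 'rV[R]_k) x : closure A x <->
  forall e, 0 < e -> exists2 a, A a & eunorm (a - x) < e.
Proof.
split=> [h e e0|h B /nbhs_eunorm[e e0 hB]].
  have /h [a [Aa xa]] : nbhs x [set y | eunorm (y - x) < e].
    by apply/nbhs_eunorm; exists e.
  by exists a.
by have [a Aa xa] := h e e0; exists a; split => //; apply: hB.
Qed.

Lemma eclosedI_compact (A : set 'rV[R]_k) x e : closed A ->
  compact (A `&` [set y | eunorm (y - x) <= e]).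
Proof.
move=> cA; apply: bounded_closed_compact.
  exists (eunorm x + e); split; first exact: num_real.
  move=> M hM y [_ /= ye]; apply: le_trans (norm_le_eunorm _) _.
  rewrite -(subrK x y); apply: le_trans (eunormD _ _) _.
  lra.
apply: closedI => // y /closure_eunorm h; rewrite /= leNgt; apply/negP => ye.
have [|a /= ae ay] := h (eunorm (y - x) - e); first by rewrite subr_gt0.
have := eunorm_tri y a x; rewrite (eunormB y a); lra.
Qed.

(** Bolzano-Weierstrass in cluster-point form: instead of a subsequence, arbitrarily late indices
    close to [y]. *)
Lemma eball_cluster x e (xs : nat -> 'rV[R]_k) :
  (forall j, eunorm (xs j - x) <= e) ->
  exists2 y, eunorm (y - x) <= e &
   forall r N, 0 < r -> exists2 j, (N <= j)%N & eunorm (xs j - y) < r.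
Proof.
move=> h.
have [|y [[_ xe] cy]] := @eclosedI_compact setT x e closedT (xs @ \oo) _.
  by exists 0%N => // j _; split => //; exact: h.
exists y => // r N r0.
have [||z [[j Nj <-] zy]] := cy (xs @` [set j | (N <= j)%N])
   [set z | eunorm (z - y) < r].
- by exists N => // j Nj; exists j.
- by apply/nbhs_eunorm; exists r.
by exists j.
Qed.

Lemma continuous_eunorm (F : 'rV[R]_k -> R) :
  (forall x e, 0 < e -> exists2 r, 0 < r & forall y, eunorm (y - x) < r ->
     `|F y - F x| < e) -> continuous F.
Proof.
move=> h x B /nbhs_ballP[e /= e0 hB]; apply/nbhs_eunorm.
have [r r0 hr] := h x e e0; exists r => // y /hr xy; apply: hB.
by rewrite /ball /= distrC.
Qed.

Lemma eball_min (F : 'rV[R]_k -> R) (A : set 'rV[R]_k) x e (a : 'rV[R]_k) :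
  closed A -> continuous F -> A a -> eunorm (a - x) <= e ->
  exists y, [/\ A y, eunorm (y - x) <= e &
    forall z, A z -> eunorm (z - x) <= e -> F y <= F z].
Proof.
move=> cA cF Aa ae.
have [||y /set_mem[Ay ye] hy] :=
    @compact_EVT_min _ _ F _ _ (@eclosedI_compact A x e cA).
- by exists a.
- by apply: continuous_subspaceT.
by exists y; split => // z Az ze; apply: hy; apply/mem_set.
Qed.

Lemma eunorm_lip x y z : `|eunorm (x - z) - eunorm (y - z)| <= eunorm (x - y).
Proof.
rewrite ler_norml; apply/andP; split; have := eunorm_tri x y z;
  have := eunorm_tri y x z; rewrite (eunormB y x); lra.
Qed.

Lemma setdist_has_inf x (A : set 'rV[R]_k) : A !=set0 ->
  has_inf [set eunorm (x - a) | a in A].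
Proof.
move=> [a Aa]; split; first by exists (eunorm (x - a)), a.
by exists 0 => _ [b _ <-]; exact: eunorm_ge0.
Qed.

Lemma setdist_le x (a : 'rV[R]_k) (A : set 'rV[R]_k) : A a -> setdist x A <= eunorm (x - a).
Proof.
move=> Aa; apply: ge_inf; last by exists a.
by case: (setdist_has_inf x (ex_intro _ _ Aa)).
Qed.

Lemma setdist_ge x e (A : set 'rV[R]_k) : A !=set0 ->
  (forall a, A a -> e <= eunorm (x - a)) -> e <= setdist x A.
Proof.
move=> [a Aa] h; apply: lb_le_inf; first by exists (eunorm (x - a)), a.
by move=> _ [b Ab <-]; exact: h.
Qed.

Lemma setdist_ge0 x (A : set 'rV[R]_k) : A !=set0 -> 0 <= setdist x A.
Proof. by move=> A0; apply: setdist_ge => // a _; exact: eunorm_ge0. Qed.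

Lemma setdist_near x e (A : set 'rV[R]_k) : A !=set0 -> setdist x A < e ->
  exists2 a, A a & eunorm (x - a) < e.
Proof.
move=> A0 h; apply: contrapT => hn.
suff : e <= setdist x A by rewrite leNgt h.
apply: setdist_ge => // a Aa; rewrite leNgt; apply/negP => xa.
by apply: hn; exists a.
Qed.

Lemma setdist_lip x y (A : set 'rV[R]_k) : A !=set0 ->
  `|setdist x A - setdist y A| <= eunorm (x - y).
Proof.
move=> A0.
have h u v : setdist u A <= eunorm (u - v) + setdist v A.
  rewrite -lerBlDl; apply: setdist_ge => // a Aa.
  rewrite lerBlDl; apply: le_trans (eunorm_tri _ v _); exact: setdist_le.
rewrite ler_norml; apply/andP; split; have := h x y; have := h y x;
  rewrite (eunormB y x); lra.
Qed.

Lemma continuous_eunormB z : continuous (fun x => eunorm (x - z)).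
Proof.
apply: continuous_eunorm => x e e0; exists e => // y ye.
exact: le_lt_trans (eunorm_lip _ _ _) ye.
Qed.

(** It suffices to minimise over the compact part of [A] no farther from [x] than a known point [a];
    the remaining points are farther still. *)
Lemma nearest_point x (A : set 'rV[R]_k) : closed A -> A !=set0 ->
  exists2 p, A p & setdist x A = eunorm (x - p).
Proof.
move=> cA [a Aa].
have [p [Ap pa hp]] :=
  @eball_min _ A x (eunorm (a - x)) a cA (@continuous_eunormB x) Aa (lexx _).
exists p => //; apply/eqP; rewrite eq_le setdist_le //=.
apply: setdist_ge; first by exists a.
move=> b Ab; rewrite !(eunormB x).
have [/(hp _ Ab) //|ba] := leP (eunorm (b - x)) (eunorm (a - x)).
exact: le_trans pa (ltW ba).
Qed.

End Euclid.

(** * Differential calculus *)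

Section Calculus.
Variables (R : realType) (n m : nat).
Implicit Types (g : 'rV[R]_n -> 'rV[R]_m) (x a v d : 'rV[R]_n).

Lemma diff_quotient_cvg g x v : differentiable g x ->
  (fun h : R => h^-1 *: (g (h *: v + x) - g x)) @ 0^' --> 'd g x v.
Proof.
by move=> dg; rewrite -deriveE //; exact: (@diff_derivable _ _ _ g x v dg).
Qed.

Lemma is_derive_path g a v (i : 'I_m) (t : R) : differentiable g (a + t *: v) ->
  is_derive t 1 (fun s : R => g (a + s *: v) 0 i) ('d g (a + t *: v) v 0 i).
Proof.
move=> dg.
have h : (fun h : R => h^-1 *: (g (a + (h *: 1 + t) *: v) 0 i - g (a + t *: v) 0 i))
    @ 0^' --> 'd g (a + t *: v) v 0 i.
  rewrite [X in X @ _ --> _](_ : _ = (fun M : 'rV[R]_m => M 0 i) \o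
    (fun h : R => h^-1 *: (g (h *: v + (a + t *: v)) - g (a + t *: v)))); last first.
    apply/funext => s /=; rewrite !mxE; congr (_ * (g _ _ _ - _)).
    by rewrite [s *: 1]mulr1 scalerDl addrCA.
  apply: cvg_comp; first exact: diff_quotient_cvg.
  exact: coord_continuous.
by apply: DeriveDef; [apply/cvg_ex; eexists; exact: h|exact: cvg_lim].
Qed.

(** Stated for one coordinate because the intermediate point depends on the coordinate. *)
Lemma diff_path_mvt g a v (i : 'I_m) : (forall x, differentiable g x) ->
  exists2 c : R, 0 <= c <= 1 & g (a + v) 0 i - g a 0 i = 'd g (a + c *: v) v 0 i.
Proof.
move=> dg.
have [|||c] := @MVT_segment R (fun s => g (a + s *: v) 0 i)
  (fun s => 'd g (a + s *: v) v 0 i) 0 1.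
- exact: ler01.
- by move=> s _; exact: is_derive_path.
- apply: derivable_within_continuous => s _.
  exact: (@ex_derive _ _ _ _ _ _ _ (is_derive_path i (dg (a + s *: v)))).
by rewrite in_itv /= scale1r scale0r addr0 subr0 mulr1 => c01 ->; exists c.
Qed.

Lemma continuous_eps (F : 'rV[R]_n -> 'rV[R]_m) x (e : R) : 0 < e ->
  {for x, continuous F} ->
  exists2 r, 0 < r & forall y, eunorm (y - x) < r -> eunorm (F y - F x) < e.
Proof.
move=> e0 cF; apply/nbhs_eunorm; apply: (cF [set z | eunorm (z - F x) < e]).
by apply/nbhs_eunorm; exists e.
Qed.

Lemma uniform_radius (I : finType) (P : I -> R -> Prop) :
  (forall i, exists2 r, 0 < r & P i r) ->
  (forall i r s, 0 < s -> s <= r -> P i r -> P i s) ->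
  exists2 r, 0 < r & forall i, P i r.
Proof.
move=> h mono.
have /choice[rs hrs] : forall i, exists r, 0 < r /\ P i r.
  by move=> i; have [r r0 Pr] := h i; exists r.
exists (\big[Num.min/1]_i rs i).
  by apply: lt_bigmin => // i _; case: (hrs i).
move=> i; apply: (mono i (rs i)) => //.
  by apply: lt_bigmin => // j _; case: (hrs j).
  exact: bigmin_le.
by case: (hrs i).
Qed.

(** Strict differentiability at [x]: each coordinate of the increment is a derivative at an
    intermediate point, and there the finitely many partial derivatives are uniformly close to those
    at [x]. *)
Lemma C2_strict_diff g x e : C2 g -> 0 < e ->
  exists2 r, 0 < r & forall a b, eunorm (a - x) < r -> eunorm (b - x) < r ->
    eunorm (g b - g a - 'd g x (b - a)) <= e * eunorm (b - a).
Proof.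
move=> [dg [ddg _]] e0.
(* Bounding [m] coordinates by [n] partial derivatives each costs a factor [m * n]; the 1 avoids a
   zero divisor. *)
pose e1 := e / (m%:R * n%:R + 1).
have mn1 : 0 < m%:R * n%:R + 1 :> R by rewrite ltr_wpDl // mulr_ge0.
have e10 : 0 < e1 by rewrite divr_gt0.
have [||r r0 hr] := @uniform_radius 'I_n (fun j r => forall y, eunorm (y - x) < r ->
   eunorm ('d g y (delta_mx 0 j) - 'd g x (delta_mx 0 j)) < e1).
- move=> j; apply: (@continuous_eps (fun y => 'd g y (delta_mx 0 j))) => //.
  by apply: differentiable_continuous; exact: ddg.
- by move=> j r s _ sr h y ys; apply: h; exact: lt_le_trans ys sr.
exists r => // a b ar br; set v := b - a.
apply: (@le_trans _ _ (m%:R * (n%:R * e1 * eunorm v))); last first.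
  rewrite !mulrA; apply: ler_wpM2r; first exact: eunorm_ge0.
  rewrite /e1 ?mulrA ler_pdivrMr // mulrC ler_wpM2l ?(ltW e0) //; lra.
apply: eunorm_le_coord.
  by rewrite mulr_ge0 ?eunorm_ge0 // mulr_ge0 // ltW.
move=> i; rewrite !mxE.
have [c /andP[c0 c1]] := diff_path_mvt a v i dg.
rewrite {1}/v addrCA subrr addr0 => ->.
have ep : eunorm (a + c *: v - x) < r.
  have -> : a + c *: v - x = (1 - c) *: (a - x) + c *: (b - x) by rewrite /v; vec.
  apply: le_lt_trans (eunormD _ _) _; rewrite !eunormZ.
  rewrite !ger0_norm ?subr_ge0 //.
  have [<-|cn] := eqVneq 0 c; first by lra.
  have cp : 0 < c by rewrite lt_neqAle cn.
  have h1 : (1 - c) * eunorm (a - x) <= (1 - c) * r.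
    by apply: ler_wpM2l; [lra|exact: ltW].
  have h2 : c * eunorm (b - x) < c * r by rewrite ltr_pM2l.
  lra.
have E p : 'd g p v 0 i = \sum_j v 0 j * 'd g p (delta_mx 0 j) 0 i.
  rewrite {1}(matrix_sum_delta v) big_ord1 linear_sum summxE.
  by apply: eq_bigr => j _; rewrite linearZ mxE.
apply: (@le_trans _ _ `|\sum_j v 0 j * 'd g (a + c *: v) (delta_mx 0 j) 0 i -
    \sum_j v 0 j * 'd g x (delta_mx 0 j) 0 i|).
  by rewrite le_eqVlt; apply/orP; left; apply/eqP; congr (`|_ - _|); exact: E.
rewrite -sumrB.
apply: le_trans (ler_norm_sum _ _ _) _.
rewrite -[X in X%:R * _ * _]card_ord -mulrA mulr_natl -sumr_const.
apply: ler_sum => j _; rewrite -mulrBr normrM mulrC.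
apply: ler_pM => //; last exact: coord_le_eunorm.
have := coord_le_eunorm ('d g (a + c *: v) (delta_mx 0 j) - 'd g x (delta_mx 0 j)) i.
by rewrite !mxE => h; apply: (le_trans h); exact/ltW/hr.
Qed.

Lemma diff_dir_eps g x d e : 0 < e -> differentiable g x ->
  exists2 r, 0 < r & forall c : R, 0 < c -> c < r ->
    eunorm (g (x + c *: d) - g x - c *: 'd g x d) <= e * c.
Proof.
move=> e0 dg; have := @diff_quotient_cvg g x d dg.
move=> /(_ [set y | eunorm (y - 'd g x d) < e]) [].
  by apply/nbhs_eunorm; exists e.
move=> r /= r0 h; exists r => // c c0 cr.
have := h c; rewrite /ball_ /= sub0r normrN gtr0_norm // => /(_ cr).
rewrite gt_eqF // => /(_ isT) hc.
have -> : g (x + c *: d) - g x - c *: 'd g x d =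
   c *: (c^-1 *: (g (c *: d + x) - g x) - 'd g x d).
  by rewrite scalerBr scalerA mulfV ?gt_eqF // scale1r (addrC (c *: d)).
by rewrite eunormZ gtr0_norm // mulrC ler_pM2r // ltW.
Qed.

(** The mean value theorem is applied to [F] minus its quadratic polynomial, coordinate by
    coordinate: the derivative of this difference is a coordinate of [G c - L - c *: H], which the
    first-order expansion of [G] at 0 controls. *)
Lemma path_second_order (F G : R -> 'rV[R]_m) (L H : 'rV[R]_m) (e r t : R) :
  0 <= e -> (forall (s : R) i, is_derive s 1 (fun s => F s 0 i) (G s 0 i)) ->
  (forall c, 0 < c -> c < r -> eunorm (G c - L - c *: H) <= e * c) ->
  0 < t -> t < r ->
  eunorm (F t - (F 0 + t *: L + (2^-1 * t ^+ 2) *: H)) <= m%:R * (e * t ^+ 2).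
Proof.
move=> e0 dF hG t0 tr.
apply: eunorm_le_coord; first by rewrite mulr_ge0 ?sqr_ge0.
move=> i.
pose f (s : R) := F s 0 i - (s * L 0 i + 2^-1 * s ^+ 2 * H 0 i).
pose df (s : R) := G s 0 i - (L 0 i + s * H 0 i).
have iF (s : R) : is_derive s 1 f (df s).
  apply: is_deriveB.
  by apply: is_derive_eq; rewrite /GRing.scale /=; lra.
have cf : {within `[0, t], continuous f}.
  apply: derivable_within_continuous => s _.
  exact: (@ex_derive _ _ _ _ _ _ _ (iF s)).
have [c] := @MVT R f df 0 t t0 (fun s _ => iF s) cf.
rewrite in_itv /= => /andP[c0 ct] E.
have -> : (F t - (F 0 + t *: L + (2^-1 * t ^+ 2) *: H)) 0 i = f t - f 0.
  rewrite !mxE /f; ring.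
rewrite E subr0 normrM (gtr0_norm t0) expr2 mulrA ler_pM2r //.
apply: (@le_trans _ _ (e * c)); last by rewrite ler_wpM2l // ltW.
have := hG c c0 (lt_trans ct tr); apply: le_trans.
have := coord_le_eunorm (G c - L - c *: H) i.
by rewrite !mxE /df opprD addrA.
Qed.

Lemma C2_second_order g x d (e : R) : C2 g -> 0 < e ->
  exists2 r, 0 < r & forall t : R, 0 < t -> t < r ->
    eunorm (g (x + t *: d) - (g x + t *: 'd g x d + (2^-1 * t ^+ 2) *: hess2 g x d))
      <= e * t ^+ 2.
Proof.
move=> [dg [ddg _]] e0.
have m1 : 0 < m%:R + 1 :> R by rewrite ltr_wpDl.
have e10 : 0 < e / (m%:R + 1) by rewrite divr_gt0.
have [r r0 hr] := @diff_dir_eps (fun y => 'd g y d) x d _ e10 (ddg d x).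
exists r => // t t0 tr.
have := @path_second_order (fun s => g (x + s *: d)) (fun s => 'd g (x + s *: d) d)
  ('d g x d) (hess2 g x d) (e / (m%:R + 1)) r t (ltW e10)
  (fun s i => is_derive_path i (dg (x + s *: d))) hr t0 tr.
rewrite scale0r addr0 => /le_trans; apply.
rewrite mulrA; apply: ler_wpM2r; first exact: sqr_ge0.
rewrite mulrA ler_pdivrMr // mulrC ler_wpM2l ?(ltW e0) //; lra.
Qed.

End Calculus.

(** * Tangent and normal cones *)

Section Cones.
Variables (R : realType) (k : nat).
Implicit Types (A K : set 'rV[R]_k) (x y u v d z p : 'rV[R]_k).

Lemma harmonic_lt (e : R) : 0 < e ->
  exists N, forall j, (N <= j)%N -> j.+1%:R^-1 < e.
Proof.
by move=> e0; have [N _ hN] := near_infty_natSinv_lt (PosNum e0); exists N.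
Qed.

Lemma harmonic_gt0 j : 0 < j.+1%:R^-1 :> R.
Proof. by rewrite invr_gt0 ltr0n. Qed.

Lemma down0_harmonic (t : nat -> R) : (forall j, 0 < t j < j.+1%:R^-1) -> down0 t.
Proof.
move=> h; split=> [j|]; first by case/andP: (h j).
apply/cvgrPdist_lt => e e0; have [N hN] := harmonic_lt e0.
exists N => // j Nj; rewrite /= sub0r normrN; case/andP: (h j) => t0 t1.
by rewrite gtr0_norm //; apply: lt_trans t1 _; exact: hN.
Qed.

Lemma cvg_harmonic (xs : nat -> 'rV[R]_k) x :
  (forall j, eunorm (xs j - x) < j.+1%:R^-1) -> xs @ \oo --> x.
Proof.
move=> h; apply/cvg_eunorm => e e0; have [N hN] := harmonic_lt e0.
by exists N => j Nj; apply: lt_trans (h j) _; exact: hN.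
Qed.

Lemma cvg0_eps (t : nat -> R) (e : R) : t @ \oo --> 0 -> 0 < e ->
  exists N, forall j, (N <= j)%N -> `|t j| < e.
Proof.
move=> /cvgrPdist_lt h e0; have [N _ hN] := h e e0.
by exists N => j Nj; have := hN j Nj; rewrite /= sub0r normrN.
Qed.

Lemma down0_eps (t : nat -> R) (e : R) : down0 t -> 0 < e ->
  exists N, forall j, (N <= j)%N -> t j < e.
Proof.
move=> [t0 ct] e0; have [N hN] := cvg0_eps ct e0; exists N => j /hN.
by rewrite gtr0_norm.
Qed.

(** Sequence-free form: tangency is checked for one tolerance at a time, and choice along the
    tolerances 1/(j+1) rebuilds the sequences. *)
Lemma Tcone_eps A x d : Tcone A x d <-> forall e : R, 0 < e ->
  exists (t : R) d', [/\ 0 < t, t < e, eunorm (d' - d) < e & A (x + t *: d')].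
Proof.
split=> [[t [ds [dt [/cvg_eunorm cd hA]]]] e e0|h].
  have [N1 h1] := down0_eps dt e0; have [N2 h2] := cd e e0.
  exists (t (maxn N1 N2)), (ds (maxn N1 N2)); split => //.
  - by case: dt.
  - by apply: h1; rewrite leq_maxl.
  - by apply: h2; rewrite leq_maxr.
have /choice[td htd] : forall j, exists td : R * 'rV[R]_k,
    [/\ 0 < td.1, td.1 < j.+1%:R^-1, eunorm (td.2 - d) < j.+1%:R^-1 &
     A (x + td.1 *: td.2)].
  by move=> j; have [t [d' ?]] := h _ (harmonic_gt0 j); exists (t, d').
exists (fun j => (td j).1), (fun j => (td j).2); split; last split.
- by apply: down0_harmonic => j; case: (htd j) => -> ->.
- by apply: cvg_harmonic => j; case: (htd j).
- by move=> j; case: (htd j).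
Qed.

Lemma Tcone0 A x : A x -> Tcone A x 0.
Proof.
move=> Ax; apply/Tcone_eps => e e0; exists (e / 2), 0.
by rewrite scaler0 addr0 subrr eunorm0 divr_gt0 // ltr_pdivrMr // ltr_pMr // ltr1n.
Qed.

Lemma T2set_eps A x d w (e : R) : T2set A x d w -> 0 < e ->
  exists (t : R) w', [/\ 0 < t, t < e, eunorm (w' - w) < e &
    A (x + t *: d + (2^-1 * t ^+ 2) *: w')].
Proof.
move=> [t [ws [dt [/cvg_eunorm cw hA]]]] e0.
have [N1 h1] := down0_eps dt e0; have [N2 h2] := cw e e0.
exists (t (maxn N1 N2)), (ws (maxn N1 N2)); split => //.
- by case: dt.
- by apply: h1; rewrite leq_maxl.
- by apply: h2; rewrite leq_maxr.
Qed.

Lemma T2asym_eps A x d w (e : R) : T2asym A x d w -> 0 < e ->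
  exists (t r : R) w', [/\ 0 < t, t < e, 0 < r & r < e] /\
    [/\ t < e * r, eunorm (w' - w) < e & A (x + t *: d + (2^-1 * t * r) *: w')].
Proof.
move=> [t [r [ws [dt [dr [/cvg0_eps ctr [/cvg_eunorm cw hA]]]]]]] e0.
have [N1 h1] := down0_eps dt e0; have [N2 h2] := cw e e0.
have [N3 h3] := down0_eps dr e0; have [N4 h4] := ctr e e0.
pose N := maxn (maxn N1 N2) (maxn N3 N4).
have [M1 M2 M3 M4] : [/\ N1 <= N, N2 <= N, N3 <= N & N4 <= N]%N.
  by rewrite /N !leq_max !leqnn !orbT.
have [t0 r0] : 0 < t N /\ 0 < r N by case: dt => t0 _; case: dr.
exists (t N), (r N), (ws N); split; split => //; [exact: h1|exact: h3| |exact: h2].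
have := h4 _ M4; rewrite gtr0_norm ?divr_gt0 // ltr_pdivrMr //.
Qed.

(** Bounded directions cluster, and a cluster point taken along vanishing steps is tangent. *)
Lemma Tcone_limit A x d (M : R) :
  (forall e : R, 0 < e -> exists (t : R) d', [/\ 0 < t, t < e, eunorm (d' - d) <= M &
     A (x + t *: d')]) ->
  exists2 d0, Tcone A x d0 & eunorm (d0 - d) <= M.
Proof.
move=> h.
have /choice[td htd] : forall j, exists td : R * 'rV[R]_k,
    [/\ 0 < td.1, td.1 < j.+1%:R^-1, eunorm (td.2 - d) <= M & A (x + td.1 *: td.2)].
  by move=> j; have [t [d' ?]] := h _ (harmonic_gt0 j); exists (t, d').
have [|d0 d0M hc] := @eball_cluster R k d M (fun j => (td j).2).
  by move=> j; case: (htd j).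
exists d0 => //; apply/Tcone_eps => e e0.
have [N hN] := harmonic_lt e0; have [j Nj jd] := hc e N e0.
exists (td j).1, (td j).2; case: (htd j) => t0 t1 _ hA; split => //.
by apply: lt_trans t1 _; exact: hN.
Qed.

(** Compactness of the unit ball turns approximate unit normals into a directional limiting normal
    of norm 1. The relation [Q] carries a side condition on the approximating normals, which the
    caller passes to the limit. *)
Lemma Ndir_limit K y u (Q : R -> 'rV[R]_k -> Prop) :
  (forall e : R, 0 < e -> exists (t : R) p v, [/\ 0 < t, t < e,
     eunorm (p - (y + t *: u)) <= e * t & [/\ Fnormal K p v, eunorm v = 1 & Q e v]]) ->
  exists v, [/\ Ndir K y u v, eunorm v = 1 & forall e : R, 0 < e ->
    exists r v', [/\ 0 < r, r < e, eunorm (v' - v) < e & Q r v']].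
Proof.
move=> h.
have /choice[T hT] : forall j, exists T : R * 'rV[R]_k * 'rV[R]_k,
    [/\ 0 < T.1.1, T.1.1 < j.+1%:R^-1,
     eunorm (T.1.2 - (y + T.1.1 *: u)) <= j.+1%:R^-1 * T.1.1 &
     [/\ Fnormal K T.1.2 T.2, eunorm T.2 = 1 & Q j.+1%:R^-1 T.2]].
  by move=> j; have [t [p [v ?]]] := h _ (harmonic_gt0 j); exists (t, p, v).
have [|v v1 hc] := @eball_cluster R k 0 1 (fun j => (T j).2).
  by move=> j; rewrite subr0; case: (hT j) => _ _ _ [_ -> _].
exists v; split.
(* Since [N j] exceeds [j], the bounds on steps and base points along the selected indices stay
   below 1/(j+1), while the normals now converge. *)
- have /choice[N hN] : forall j, exists N, (j.+1 <= N)%N /\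
      eunorm ((T N).2 - v) < j.+1%:R^-1.
    by move=> j; have [N Nj Nv] := hc _ j.+1 (harmonic_gt0 j); exists N.
  have hlt j : (N j).+1%:R^-1 < j.+1%:R^-1 :> R.
    by rewrite ltf_pV2 ?posrE ?ltr0n // ltr_nat ltnS; case: (hN j).
  exists (fun j => (T (N j)).1.1), (fun j => (T (N j)).1.1^-1 *: ((T (N j)).1.2 - y)),
    (fun j => (T (N j)).2); split; last split; last split.
  + apply: down0_harmonic => j; case: (hT (N j)) => -> /= t1 _ _.
    exact: lt_trans t1 (hlt j).
  + apply: cvg_harmonic => j; case: (hT (N j)) => t0 _ hp _.
    have -> : (T (N j)).1.1^-1 *: ((T (N j)).1.2 - y) - u =
       (T (N j)).1.1^-1 *: ((T (N j)).1.2 - (y + (T (N j)).1.1 *: u)).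
      by rewrite opprD addrA [RHS]scalerBr scalerA mulVf ?gt_eqF // scale1r.
    rewrite eunormZ gtr0_norm ?invr_gt0 // mulrC ltr_pdivrMr //.
    by apply: le_lt_trans hp _; rewrite ltr_pM2r.
  + by apply: cvg_harmonic => j; case: (hN j).
  + move=> j; case: (hT (N j)) => t0 _ _ [hF _ _].
    by rewrite scalerA mulfV ?gt_eqF // scale1r addrCA subrr addr0.
- apply/eqP; rewrite eq_le -{1}[v]subr0 v1 /= leNgt; apply/negP => v1'.
  have [|j _ jv] := hc (1 - eunorm v) 0%N; first by rewrite subr_gt0.
  case: (hT j) => _ _ _ [_ e1 _].
  have := eunorm_tri (T j).2 v 0; rewrite !subr0 e1; lra.
- move=> e e0; have [N hN] := harmonic_lt e0; have [j Nj jv] := hc e N e0.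
  exists j.+1%:R^-1, (T j).2; case: (hT j) => _ _ _ [_ _ hQ].
  by split => //; exact: hN.
Qed.

(** Squaring the nearest-point inequality gives 2 <z - p, q - p> <= |q - p|^2, which is of second
    order in q - p; hence the radius [e * eunorm (z - p)]. *)
Lemma nearest_Fnormal K z p : K p -> 0 < eunorm (z - p) ->
  (forall q, K q -> eunorm (z - p) <= eunorm (z - q)) ->
  Fnormal K p ((eunorm (z - p))^-1 *: (z - p)).
Proof.
move=> Kp zp0 h; split => // e e0; exists (e * eunorm (z - p)); split.
  by rewrite mulr_gt0.
move=> q Kq; set D := eunorm (z - p); set L := eunorm (q - p) => qp.
have L0 : 0 <= L := eunorm_ge0 _.
rewrite dotvZl mulrC ler_pdivrMr //.
have : D ^+ 2 <= eunorm (z - q) ^+ 2 by rewrite lerXn2r ?nnegrE ?eunorm_ge0 // h.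
have -> : z - q = (z - p) - (q - p) by vec.
rewrite /D /L in zp0 L0 qp *; move: (z - p) (q - p) zp0 L0 qp => a b a0 b0 qp.
rewrite !sqr_eunorm !dotvE (dotvC b a) -!sqr_eunorm => hh.
have : eunorm b * eunorm b <= eunorm b * (e * eunorm a).
  by apply: ler_wpM2l => //; exact: ltW.
have := sqr_ge0 (eunorm b); lra.
Qed.

Lemma FnormalZ K p v (c : R) : 0 <= c -> Fnormal K p v -> Fnormal K p (c *: v).
Proof.
move=> c0 [Kp h]; split => // e e0.
have [|r [r0 hr]] := h (e / (c + 1)); first by rewrite divr_gt0 //; lra.
exists r; split => // q Kq qr; rewrite dotvZl.
apply: le_trans (ler_wpM2l c0 (hr _ Kq qr)) _.
rewrite mulrA; apply: ler_wpM2r; first exact: eunorm_ge0.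
rewrite mulrA ler_pdivrMr; last lra.
rewrite mulrC ler_wpM2l ?(ltW e0) //; lra.
Qed.

(** Zero is a Fréchet normal at every point of [K], and tangency of [u] supplies points of [K] along
    the direction. *)
Lemma Ndir0 K y u : Tcone K y u -> Ndir K y u 0.
Proof.
move=> [t [us [dt [cu hK]]]]; exists t, us, (fun=> 0); split => //; split => //.
split; first exact: cvg_cst.
move=> j; split => // e e0; exists 1; split => // q _ _.
by rewrite dotv0l mulr_ge0 ?eunorm_ge0 // ltW.
Qed.

Lemma NdirZ K y u v (c : R) : 0 <= c -> Ndir K y u v -> Ndir K y u (c *: v).
Proof.
move=> c0 [t [us [vs [dt [cu [cv hF]]]]]].
exists t, us, (fun j => c *: vs j); split => //; split => //; split.
  exact: cvgZl_tmp.
by move=> j; apply: FnormalZ.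
Qed.

Lemma convhull_sub A v : A v -> convhull A v.
Proof.
move=> Av; exists 1%N, (fun=> v), (fun=> 1); split => //; split => //.
by rewrite !big_ord1 scale1r.
Qed.

(** For a cone, the sum is the midpoint of the doubled vectors: the two combinations are
    concatenated with points doubled and weights halved. *)
Lemma convhull_add A u v : (forall (c : R) w, 0 <= c -> A w -> A (c *: w)) ->
  convhull A u -> convhull A v -> convhull A (u + v).
Proof.
move=> hA [p [a [l [Aa [l0 [l1 ->]]]]]] [q [b [r [Ab [r0 [r1 ->]]]]]].
exists (p + q)%N, (fun i => match fintype.split i with inl j => 2 *: a j | inr j => 2 *: b j end),
  (fun i => match fintype.split i with inl j => 2^-1 * l j | inr j => 2^-1 * r j end).
split; last split; last split.
- by move=> i; case: (fintype.split i) => j; apply: hA.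
- by move=> i; case: (fintype.split i) => j; rewrite mulr_ge0 // invr_ge0.
- rewrite big_split_ord /=.
  rewrite (eq_bigr (fun i => 2^-1 * l i)); last first.
    by move=> i _; rewrite -/(unsplit (inl i)) unsplitK.
  rewrite [X in _ + X](eq_bigr (fun i => 2^-1 * r i)); last first.
    by move=> i _; rewrite -/(unsplit (inr i)) unsplitK.
  by rewrite -!mulr_sumr l1 r1; lra.
- rewrite big_split_ord /=; congr (_ + _); apply: eq_bigr => i _.
    rewrite -/(unsplit (inl i)) unsplitK scalerA mulrAC mulVf ?mul1r //.
  by rewrite -/(unsplit (inr i)) unsplitK scalerA mulrAC mulVf ?mul1r.
Qed.

Lemma convhullZ A v (c : R) : (forall w, A w -> A (c *: w)) ->
  convhull A v -> convhull A (c *: v).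
Proof.
move=> hA [p [a [l [Aa [l0 [l1 ->]]]]]].
exists p, (fun i => c *: a i), l; split; first by move=> i; apply: hA.
split => //; split => //; rewrite scaler_sumr; apply: eq_bigr => i _.
by rewrite !scalerA mulrC.
Qed.

Lemma NCdir_sub K y u v : Ndir K y u v -> NCdir K y u v.
Proof. by move=> h; apply: subset_closure; exact: convhull_sub. Qed.

Lemma NCdirD K y u v w : NCdir K y u v -> NCdir K y u w -> NCdir K y u (v + w).
Proof.
move=> /closure_eunorm hv /closure_eunorm hw; apply/closure_eunorm => e e0.
have e2 : 0 < e / 2 by rewrite divr_gt0.
have [a Aa av] := hv _ e2; have [b Ab bw] := hw _ e2.
exists (a + b); first by apply: convhull_add => // c z c0; exact: NdirZ.
have -> : a + b - (v + w) = (a - v) + (b - w) by vec.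
apply: le_lt_trans (eunormD _ _) _; lra.
Qed.

Lemma NCdirZ K y u v (c : R) : 0 <= c -> NCdir K y u v -> NCdir K y u (c *: v).
Proof.
move=> c0 /closure_eunorm hv; apply/closure_eunorm => e e0.
have [|a Aa av] := hv (e / (c + 1)); first by rewrite divr_gt0 //; lra.
exists (c *: a); first by apply: convhullZ => // w; exact: NdirZ.
rewrite -scalerBr eunormZ ger0_norm //.
move: av; rewrite ltr_pdivlMr; last lra.
by apply: le_lt_trans; rewrite mulrC ler_wpM2l ?eunorm_ge0 //; lra.
Qed.

(** Squaring the proximal inequality at the point [x + t *: d'] gives 2 tau <p, d'> <= t |d'|^2,
    whose right-hand side vanishes with [t]. *)
Lemma NPcone_Tcone_le0 A x p d : NPcone A x p -> Tcone A x d -> dotv p d <= 0.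
Proof.
move=> [Ax [tau [tau0 hp]]] /Tcone_eps hd; rewrite leNgt; apply/negP => pd.
set c := dotv p d in pd; set P := eunorm p; set D := eunorm d.
have P0 : 0 <= P := eunorm_ge0 _; have D0 : 0 <= D := eunorm_ge0 _.
(* The first two summands collect the errors, per unit of [e], from replacing [d] by [d'] and from
   the quadratic term; the summand [c] makes [M] positive and [e] at most 1. Then [e * M = c / 2] is
   too small to compensate a positive [c]. *)
pose M := P + (D + 1) ^+ 2 / tau + c.
have M0 : 0 < M by rewrite /M ltr_wpDl // addr_ge0 // divr_ge0 ?sqr_ge0 // ltW.
pose e := c / (2 * M).
have e0 : 0 < e by rewrite /e divr_gt0 // mulr_gt0.
have eM : e * M = c / 2.
  by rewrite /e invfM mulrA -mulrA mulVf ?gt_eqF // mulr1.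
have [t [d' [t0 te d'e hA]]] := hd e e0.
have := hp _ hA.
rewrite opprD !addrA => hh.
have {hh} : eunorm (x + tau *: p - x) ^+ 2 <= eunorm (x + tau *: p - x - t *: d') ^+ 2.
  by rewrite lerXn2r ?nnegrE ?eunorm_ge0.
have -> : x + tau *: p - x = tau *: p by vec.
rewrite sqr_eunorm -/P !dotvE.
rewrite sqr_eunorm !dotvE (dotvC d' p) => h1.
have dd : dotv d' d' <= (D + 1) ^+ 2.
  rewrite -sqr_eunorm lerXn2r ?nnegrE ?eunorm_ge0 //; first lra.
  have := eunorm_tri d' d 0; rewrite !subr0 -/D.
  have : e <= 1.
    rewrite /e ler_pdivrMr ?mulr_gt0 // mul1r /M.
    have : 0 <= (D + 1) ^+ 2 / tau by rewrite divr_ge0 ?sqr_ge0 // ltW.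
    lra.
  lra.
have pd' : c - P * e <= dotv p d'.
  have : `|dotv p (d' - d)| <= P * e.
    apply: le_trans (dotv_abs_le _ _) _; apply: ler_wpM2l => //; exact: ltW.
  rewrite ler_norml dotvDr dotvNr -/c => /andP[h _]; lra.
have h2 : 2 * tau * dotv p d' <= t * (D + 1) ^+ 2.
  have : t * (2 * tau * dotv p d') <= t * (t * dotv d' d') by lra.
  rewrite ler_pM2l // => h; apply: le_trans h _; rewrite ler_pM2l //.
have h3 : 2 * dotv p d' <= e * ((D + 1) ^+ 2 / tau).
  rewrite mulrA ler_pdivlMr // mulrAC; apply: le_trans h2 _.
  by apply: ler_wpM2r; [exact: sqr_ge0|exact: ltW].
have : 0 <= e * ((D + 1) ^+ 2 / tau).
  by rewrite mulr_ge0 ?(ltW e0) // divr_ge0 ?sqr_ge0 // ltW.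
have : 0 <= e * P by rewrite mulr_ge0 // ltW.
have : 0 < e * c by rewrite mulr_gt0.
move: eM; rewrite /M !mulrDr; lra.
Qed.

End Cones.

(** * Directional Clarke tangents *)

Section Tangent.
Variable R : realType.

Lemma pos_min (a b : R) : 0 < a -> 0 < b -> exists r, [/\ 0 < r, r <= a & r <= b].
Proof.
by move=> a0 b0; exists (Num.min a b); rewrite lt_min a0 b0 !ge_min !lexx orbT.
Qed.

Lemma pos_mins (s : seq R) : all (fun a => 0 < a) s ->
  exists2 r, 0 < r & all (fun a => r <= a) s.
Proof.
elim: s => [|a s IH] /=; first by exists 1.
move=> /andP[a0 /IH[q q0 qs]]; have [r [r0 ra rq]] := pos_min a0 q0.
by exists r => //; rewrite ra; apply: sub_all qs => b; exact: le_trans.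
Qed.

(** Stands in for letting [t] tend to 0 in an inequality with an error linear in [t]. *)
Lemma le_small (a b c t0 : R) : 0 < t0 ->
  (forall t, 0 < t -> t <= t0 -> a <= b + t * c) -> a <= b.
Proof.
move=> t00 h; rewrite leNgt; apply/negP => ba.
have c1 : 0 < `|c| + 1 by rewrite ltr_wpDl.
have ab : 0 < (a - b) / 2 by rewrite divr_gt0 ?subr_gt0.
have [t [tp tt0 tab]] := pos_min t00 (divr_gt0 ab c1).
have := h t tp tt0; move: tab; rewrite ler_pdivlMr // => tab.
have : t * c <= t * `|c| by rewrite ler_pM2l // ler_norm.
lra.
Qed.

(** An upper quadratic model of the norm: with D = |a|, the right-hand side equals (D^2 + |a + w|^2)
    / (2 D), which is at least |a + w| because (D - |a + w|)^2 >= 0. *)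
Lemma eunorm_perturb k (a w : 'rV[R]_k) : 0 < eunorm a ->
  eunorm (a + w) <= eunorm a + dotv ((eunorm a)^-1 *: a) w
    + eunorm w ^+ 2 / (2 * eunorm a).
Proof.
move=> a0; rewrite dotvZl; set D := eunorm a in a0 *.
have -> : D + D^-1 * dotv a w + eunorm w ^+ 2 / (2 * D) =
   (D ^+ 2 + eunorm (a + w) ^+ 2) / (2 * D).
  rewrite (sqr_eunorm (a + w)) !dotvE (dotvC w a) -!sqr_eunorm -/D.
  by field; rewrite gt_eqF.
rewrite ler_pdivlMr; last lra.
have := sqr_ge0 (D - eunorm (a + w)); lra.
Qed.

Section Clarke.
Variables (k : nat) (K : set 'rV[R]_k) (y u v : 'rV[R]_k).
Hypothesis hv : forall l, Ndir K y u l -> dotv l v <= 0.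

(** Otherwise unit normals with product at least [e] would accumulate at a directional normal whose
    product with [v] is positive, against [hv]. *)
Lemma normal_dot_small (e : R) : 0 < e ->
  exists2 r : R, 0 < r & forall t p l, 0 < t -> t < r ->
    eunorm (p - (y + t *: u)) <= r * t -> Fnormal K p l -> eunorm l = 1 ->
    dotv l v < e.
Proof.
move=> e0; apply: contrapT => hn.
have [|l [Nl l1 hl]] := @Ndir_limit _ _ K y u (fun _ l => e <= dotv l v).
  move=> r r0; apply: contrapT => hr; apply: hn; exists r => // t p l t0 tr pr Fl l1.
  by rewrite ltNge; apply/negP => el; apply: hr; exists t, p, l.
have v1 : 0 < eunorm v + 1 by rewrite ltr_wpDl ?eunorm_ge0.
have [r [l' [_ _ ll el]]] := hl _ (divr_gt0 e0 v1).
have := hv Nl.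
have : dotv (l' - l) v <= eunorm (l' - l) * eunorm v by exact: dotv_le.
move: ll; rewrite ltr_pdivlMr // dotvDl dotvNl.
have := eunorm_ge0 (l' - l); lra.
Qed.

(** If the distance along the segment ended above [e * s], it would leave a line of slope [e / 2]
    for good at some last parameter [c]. To the right of [c] it grows at rate at least [e / 2],
    whereas [eunorm_perturb] bounds this rate by the product of [v] with the unit proximal normal at
    [c]. *)
Lemma setdist_path_le (e s : R) y' : closed K -> K y' -> 0 < e -> 0 < s ->
  (forall c p, 0 <= c -> c <= s -> K p ->
     setdist (y' + c *: v) K = eunorm (y' + c *: v - p) ->
     0 < eunorm (y' + c *: v - p) ->
     dotv ((eunorm (y' + c *: v - p))^-1 *: (y' + c *: v - p)) v < e / 2) ->
  setdist (y' + s *: v) K <= e * s.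
Proof.
move=> cK Ky e0 s0 H.
have K0 : K !=set0 by exists y'.
pose D c := setdist (y' + c *: v) K.
have es : 0 < e * s by rewrite mulr_gt0.
have lip a b : D b <= D a + `|b - a| * eunorm v.
  have := setdist_lip (y' + b *: v) (y' + a *: v) K0.
  have -> : y' + b *: v - (y' + a *: v) = (b - a) *: v by vec.
  rewrite eunormZ -/(D a) -/(D b) ler_norml => /andP[_]; lra.
rewrite leNgt; apply/negP; rewrite -/(D s) => Ds.
(* The intercept [e / 4 * s] serves twice: it keeps the distance at [c = sup E] positive, so that
   the unit normal exists, and the line still ends at 3/4 of [e * s], so that [c < s]. *)
pose E := [set c | [/\ 0 <= c, c <= s & D c <= e / 2 * c + e / 4 * s]].
have E0 : E 0.
  split => //; first exact: ltW.
  have : D 0 <= eunorm (y' + 0 *: v - y') by exact: setdist_le.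
  rewrite scale0r addr0 subrr eunorm0; lra.
have Eub : ubound E s by move=> c [].
have hE : has_sup E by split; [exists 0|exists s].
pose c := sup E.
have c0 : 0 <= c by apply: ub_le_sup => //; case: hE.
have cs : c <= s by apply: sup_le_ub => //; exists 0.
have Dc : D c <= e / 2 * c + e / 4 * s.
  apply: (@le_small _ _ (eunorm v) 1) => // t t0 _.
  have [b Eb bc] := sup_adherent t0 hE.
  have bc' : b <= c by apply: ub_le_sup => //; case: hE.
  case: Eb => b0 _ Db; have := lip b c.
  rewrite ger0_norm ?subr_ge0 // => h.
  have : (c - b) * eunorm v <= t * eunorm v.
    by apply: ler_wpM2r; [exact: eunorm_ge0|rewrite -/c in bc; lra].
  have : e * b <= e * c by rewrite ler_pM2l.
  lra.
have cls : c < s.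
  rewrite lt_neqAle cs andbT; apply/eqP => cE; move: Dc; rewrite cE; lra.
have Dup t : 0 < t -> t <= s - c -> e / 2 * (c + t) + e / 4 * s < D (c + t).
  move=> t0 ts; rewrite ltNge; apply/negP => h.
  have : c + t <= c by apply: ub_le_sup; [case: hE|split => //; lra].
  lra.
have D0 : e / 4 * s <= D c.
  apply: (@le_small _ _ (eunorm v) (s - c)); first by rewrite subr_gt0.
  move=> t t0 ts; have := Dup t t0 ts; have := lip c (c + t).
  rewrite addrAC subrr add0r gtr0_norm //.
  have : 0 <= e * (c + t) by rewrite mulr_ge0 ?(ltW e0) //; lra.
  lra.
have [p Kp Dp] := nearest_point (y' + c *: v) cK K0.
have p0 : 0 < eunorm (y' + c *: v - p) by rewrite -Dp -/(D c); lra.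
have := H c p c0 cs Kp Dp p0.
set a := y' + c *: v - p in p0 *; set q := dotv _ v => hq.
have : e / 2 <= q.
  apply: (@le_small _ _ (eunorm v ^+ 2 / (2 * eunorm a)) (s - c)).
    by rewrite subr_gt0.
  move=> t t0 ts.
  have h1 := Dup t t0 ts.
  have h2 : D (c + t) <= eunorm (a + t *: v).
    have -> : a + t *: v = y' + (c + t) *: v - p by rewrite /a; vec.
    exact: setdist_le.
  have := eunorm_perturb (t *: v) p0; rewrite dotvZr -/q eunormZ gtr0_norm //.
  have Da : D c = eunorm a by exact: Dp.
  move=> h3; have : t * (e / 2) <= t * (q + t * (eunorm v ^+ 2 / (2 * eunorm a))).
    move: h3; rewrite exprMn -mulrA; move: (_ / (2 * _)) => X; lra.
  by rewrite ler_pM2l.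
lra.
Qed.

(** A projection of [y' + c *: v] on [K] lies within 2 c |v| of [y']; dividing the radius by
    [2 * eunorm v + 1] keeps it where [normal_dot_small] applies. *)
Lemma clarke_tangent (e : R) : closed K -> 0 < e ->
  exists2 r : R, 0 < r & forall t s y', 0 < t -> t < r -> 0 < s -> s <= r * t ->
    K y' -> eunorm (y' - (y + t *: u)) <= r * t ->
    setdist (y' + s *: v) K <= e * s.
Proof.
move=> cK e0.
have e20 : 0 < e / 2 by rewrite divr_gt0.
have [r r0 hr] := normal_dot_small e20.
have V0 := eunorm_ge0 v.
have V2 : 0 < 2 * eunorm v + 1 by lra.
have rV : r / (2 * eunorm v + 1) <= r.
  by rewrite ler_pdivrMr // mulrDr mulr1 lerDr mulr_ge0 ?(ltW r0) // mulr_ge0.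
exists (r / (2 * eunorm v + 1)); first by rewrite divr_gt0.
set r' := r / _ in rV *.
have r'E : r' * (2 * eunorm v + 1) = r by rewrite /r' mulfVK ?gt_eqF.
move=> t s y' t0 tr s0 sr Ky hy.
apply: setdist_path_le => // c p c0 cs Kp Dp p0.
apply: (hr t p) => //; first exact: lt_le_trans tr rV.
- have hc : c * eunorm v <= r' * t * eunorm v.
    by apply: ler_wpM2r => //; exact: le_trans cs sr.
  have h1 : eunorm (y' + c *: v - p) <= c * eunorm v.
    rewrite -Dp; apply: le_trans (setdist_le _ Ky) _.
    by rewrite addrAC subrr add0r eunormZ ger0_norm.
  have := eunorm_tri p (y' + c *: v) (y + t *: u); rewrite (eunormB p (y' + c *: v)).
  have -> : y' + c *: v - (y + t *: u) = (y' - (y + t *: u)) + c *: v by vec.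
  have := eunormD (y' - (y + t *: u)) (c *: v); rewrite eunormZ ger0_norm //.
  have : r' * (2 * eunorm v + 1) * t = r * t by rewrite r'E.
  lra.
- apply: nearest_Fnormal => // q Kq; rewrite -Dp; exact: setdist_le.
- by rewrite eunormZ gtr0_norm ?invr_gt0 // mulVf ?gt_eqF.
Qed.

End Clarke.
End Tangent.

(** * Conic duality *)

Section Duality.
Variable R : realType.

Lemma dotv_mulmx n m (J : 'M[R]_(n, m)) (z : 'rV[R]_n) (l : 'rV[R]_m) :
  dotv l (z *m J) = dotv (l *m J^T) z.
Proof.
have E k (u v : 'rV[R]_k) : dotv u v = (u *m v^T) 0 0.
  by rewrite mxE; apply: eq_bigr => i _; rewrite mxE.
by rewrite !E trmx_mul mulmxA.
Qed.

Lemma mulmx_bound n m (J : 'M[R]_(n, m)) :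
  exists2 C : R, 0 < C & forall z, eunorm (z *m J) <= C * eunorm z.
Proof.
pose C : R := \sum_j eunorm (col j J)^T.
have C0 : 0 <= C by apply: sumr_ge0 => j _; exact: eunorm_ge0.
exists (m%:R * C + 1); first by rewrite ltr_wpDl // mulr_ge0.
move=> z; have z0 := eunorm_ge0 z.
apply: (@le_trans _ _ (m%:R * (C * eunorm z))); last by lra.
apply: eunorm_le_coord; first by rewrite mulr_ge0.
move=> j; have -> : (z *m J) 0 j = dotv z (col j J)^T.
  by rewrite mxE; apply: eq_bigr => i _; rewrite !mxE.
apply: le_trans (dotv_abs_le _ _) _; rewrite mulrC ler_wpM2r //.
by rewrite /C (bigD1 j) //= lerDl; apply: sumr_ge0 => i _; exact: eunorm_ge0.
Qed.

Section Cone.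
Variables (n m : nat) (J : 'M[R]_(n, m)) (N : set 'rV[R]_m).
Hypotheses (cN : closed N) (N0 : N 0).
Hypothesis ND : forall u v, N u -> N v -> N (u + v).
Hypothesis NZ : forall (c : R) v, 0 <= c -> N v -> N (c *: v).
Hypothesis Ninj : forall l, N l -> l *m J^T = 0 -> l = 0.

Lemma continuous_mulmx_eunorm (c : 'rV[R]_n) :
  continuous (fun l : 'rV[R]_m => eunorm (l *m J^T + c)).
Proof.
apply: continuous_eunorm => x e e0; have [C C0 hC] := mulmx_bound J^T.
exists (e / C); first by rewrite divr_gt0.
move=> y; rewrite ltr_pdivlMr // => h.
have := eunorm_lip (y *m J^T) (x *m J^T) (- c); rewrite opprK => /le_lt_trans; apply.
by rewrite -mulmxBl; apply: le_lt_trans (hC _) _; rewrite mulrC.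
Qed.

(** The constant is the minimum of |l J^T| over the unit vectors of [N], positive by [Ninj]; if
    there are none, [N] is zero and any constant serves. *)
Lemma cone_mulmx_coercive :
  exists2 c : R, 0 < c & forall l, N l -> c * eunorm l <= eunorm (l *m J^T).
Proof.
pose A := N `&` [set l | eunorm l = 1].
have normalize l : N l -> l != 0 -> A ((eunorm l)^-1 *: l).
  move=> Nl l0; have e0 := eunorm_gt0 l0; split.
    by apply: NZ => //; rewrite invr_ge0 ltW.
  by rewrite /= eunormZ gtr0_norm ?invr_gt0 // mulVf ?gt_eqF.
have cA : closed A.
  apply: closedI => // x /closure_eunorm h /=.
  apply/eqP; rewrite -subr_eq0 -normr_le0; apply/ler_addgt0Pr => e e0.
  have [a /= a1 ax] := h e e0; rewrite add0r -a1 -[x]subr0 -[X in _ - eunorm X]subr0.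
  apply: le_trans (eunorm_lip _ _ _) _; rewrite eunormB; exact: ltW.
have [[a Aa]|An] := pselect (A !=set0); last first.
  exists 1 => // l Nl; have [->|l0] := eqVneq l 0.
    by rewrite mul0mx !eunorm0 mulr0.
  by exfalso; apply: An; exists ((eunorm l)^-1 *: l); exact: normalize.
have cF := @continuous_mulmx_eunorm 0.
have a1 : eunorm (a - 0) <= 1 by rewrite subr0; case: Aa => _ /= ->.
have [b [[Nb /= b1] _ hb]] := eball_min cA cF Aa a1.
have b0 : b != 0.
  apply/eqP => b0; move: b1; rewrite b0 eunorm0 => /eqP.
  by rewrite eq_sym oner_eq0.
exists (eunorm (b *m J^T)).
  by apply: eunorm_gt0; apply: contra b0 => /eqP /(Ninj Nb) ->.
move=> l Nl; have [->|l0] := eqVneq l 0; first by rewrite mul0mx !eunorm0 mulr0.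
have Al := normalize l Nl l0; have e0 := eunorm_gt0 l0.
have := hb _ Al; rewrite subr0 !addr0; case: (Al) => _ /= -> /(_ (lexx _)).
by rewrite -scalemxAl eunormZ gtr0_norm ?invr_gt0 // mulrC ler_pdivlMr.
Qed.

Section Alternative.
Variables (c : 'rV[R]_n) (b : 'rV[R]_m) (gam : R).

(** The squared violation of the system [l *m J^T = - c], [gam <= dotv l b]. *)
Definition residual (l : 'rV[R]_m) : R :=
  eunorm (l *m J^T + c) ^+ 2 + Num.max 0 (gam - dotv l b) ^+ 2.

Lemma continuous_residual : continuous residual.
Proof.
have cb : continuous (fun l : 'rV[R]_m => Num.max 0 (gam - dotv l b)).
  apply: continuous_eunorm => x e e0.
  have b1 : 0 < eunorm b + 1 by rewrite ltr_wpDl ?eunorm_ge0.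
  exists (e / (eunorm b + 1)); first by rewrite divr_gt0.
  move=> y; rewrite ltr_pdivlMr // => h.
  have : `|dotv y b - dotv x b| < e.
    rewrite -dotvNl -dotvDl; apply: le_lt_trans (dotv_abs_le _ _) _.
    apply: le_lt_trans h; apply: ler_wpM2l; [exact: eunorm_ge0|lra].
  rewrite !ltr_norml => /andP[h1 h2].
  by case: (leP 0 (gam - dotv y b)); case: (leP 0 (gam - dotv x b)) => ? ?;
     apply/andP; split; lra.
move=> x; have hF := @continuous_mulmx_eunorm c x; have hG := cb x.
exact: (cvgD (cvgM hF hF) (cvgM hG hG)).
Qed.

Lemma residual_min : exists2 l, N l & forall l', N l' -> residual l <= residual l'.
Proof.
have [c0 c00 hc] := cone_mulmx_coercive.
(* Outside this radius coercivity makes |l J^T + c| at least [1 + residual 0]; being at least 1, it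
   has a square that also exceeds [residual 0]. *)
pose r := (1 + residual 0 + eunorm c) / c0.
have res0 l : 0 <= residual l by rewrite addr_ge0 ?sqr_ge0.
have r0 : eunorm (0 - 0 : 'rV[R]_m) <= r.
  rewrite subr0 eunorm0 divr_ge0 ?(ltW c00) //.
  have := res0 0; have := eunorm_ge0 c; lra.
have [l [Nl _ hl]] := eball_min cN continuous_residual N0 r0.
exists l => // l' Nl'.
have [lr|lr] := leP (eunorm (l' - 0)) r; first exact: hl.
apply: le_trans (hl 0 N0 r0) _.
move: lr; rewrite subr0 /r ltr_pdivrMr // mulrC => lr.
have h1 := hc _ Nl'.
have h2 : eunorm (l' *m J^T) <= eunorm (l' *m J^T + c) + eunorm c.
  by have := eunormD (l' *m J^T + c) (- c); rewrite addrK eunormN.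
have h3 : 1 + residual 0 <= eunorm (l' *m J^T + c) by lra.
rewrite [leRHS]/residual; apply: (@le_trans _ _ (eunorm (l' *m J^T + c) ^+ 2)).
  have : 0 <= (eunorm (l' *m J^T + c) - 1) * eunorm (l' *m J^T + c).
    by rewrite mulr_ge0 ?eunorm_ge0 //; have := res0 0; lra.
  lra.
by rewrite lerDl sqr_ge0.
Qed.

Lemma residual_dir (l mu : 'rV[R]_m) (t : R) :
  residual (l + t *: mu) <= residual l
   + 2 * t * (dotv (l *m J^T + c) (mu *m J^T) - Num.max 0 (gam - dotv l b) * dotv mu b)
   + t ^+ 2 * (eunorm (mu *m J^T) ^+ 2 + dotv mu b ^+ 2).
Proof.
rewrite /residual.
have -> : (l + t *: mu) *m J^T + c = (l *m J^T + c) + t *: (mu *m J^T).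
  by rewrite mulmxDl scalemxAl addrAC.
move: (l *m J^T + c) (mu *m J^T) => a B.
rewrite !sqr_eunorm !dotvE (dotvC B a).
have : Num.max 0 (gam - (dotv l b + t * dotv mu b)) ^+ 2 <=
   (Num.max 0 (gam - dotv l b) - t * dotv mu b) ^+ 2.
  move: (dotv l b) (t * dotv mu b) => p q.
  have [h1|h1] := leP 0 (gam - (p + q)); have [h2|h2] := leP 0 (gam - p).
  - by rewrite opprD addrA.
  - rewrite sub0r sqrrN -[q ^+ 2]sqrrN lerXn2r ?nnegrE //; lra.
  - by rewrite expr0n sqr_ge0.
  - by rewrite expr0n sqr_ge0.
lra.
Qed.

(** A minimiser [l] of the residual over [N] either solves the system or certifies that it has no
    solution: [z] is minus the equation error at [l], and [al] is the violation of the inequality.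
    Optimality in the directions of [N] is the polarity condition. *)
Lemma cone_alternative :
  (exists l, [/\ N l, l *m J^T = - c & gam <= dotv l b]) \/
  (exists z al, [/\ 0 <= al, forall l, N l -> dotv l (z *m J) + al * dotv l b <= 0 &
     dotv c z < al * gam]).
Proof.
have [l Nl hl] := residual_min.
pose a := l *m J^T + c; pose al := Num.max 0 (gam - dotv l b).
have al0 : 0 <= al by rewrite /al le_max lexx.
have opt mu : (forall t : R, 0 < t -> t <= 1 -> N (l + t *: mu)) ->
    0 <= dotv a (mu *m J^T) - al * dotv mu b.
  move=> hN; rewrite -(@pmulr_rge0 _ 2) //.
  apply: (@le_small _ _ _ (eunorm (mu *m J^T) ^+ 2 + dotv mu b ^+ 2) 1) => // t t0 t1.
  have := le_trans (hl _ (hN t t0 t1)) (residual_dir l mu t).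
  rewrite -addrA lerDl -/a -/al => h.
  rewrite -(pmulr_rge0 _ t0) mulrDr; apply: le_trans h _; rewrite le_eqVlt.
  apply/orP; left; apply/eqP; ring.
have optN mu : N mu -> 0 <= dotv a (mu *m J^T) - al * dotv mu b.
  by move=> Nmu; apply: opt => t t0 _; apply: ND => //; apply: NZ => //; exact: ltW.
(* The cone also contains [(1 - t) *: l], so [- l] is an admissible direction; this is the half of
   complementarity that makes the final inequality strict. *)
have optl : 0 <= dotv a (- l *m J^T) - al * dotv (- l) b.
  apply: opt => t t0 t1; have -> : l + t *: - l = (1 - t) *: l by vec.
  by apply: NZ => //; rewrite subr_ge0.
have [res0|resn] := eqVneq (residual l) 0.
  left; exists l; move: res0 => /eqP; rewrite paddr_eq0 ?sqr_ge0 //.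
  rewrite !sqrf_eq0 => /andP[/eqP /eunorm_eq0 E1 /eqP E2]; split => //.
    by apply/eqP; rewrite -addr_eq0 E1.
  have : gam - dotv l b <= Num.max 0 (gam - dotv l b) by rewrite le_max lexx orbT.
  rewrite E2; lra.
right; exists (- a), al; split => //.
  move=> mu Nmu; rewrite dotv_mulmx dotvNr dotvC; have := optN mu Nmu; lra.
have resp : 0 < residual l.
  by rewrite lt_neqAle eq_sym resn addr_ge0 ?sqr_ge0.
move: resp; rewrite /residual -/a -/al sqr_eunorm.
have -> : al ^+ 2 = al * (gam - dotv l b).
  by rewrite /al; case: leP => _; rewrite ?mul0r ?expr0n.
rewrite {1}/a dotvDl dotvNr (dotvC _ a).
move: optl; rewrite mulNmx dotvNr dotvNl; lra.
Qed.

End Alternative.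

(* If the multiplier [al] of the alternative vanishes, [z] is a recession direction,
   to be added to a point [z2] with [z2 *m J + b] in the polar of [N]; such a point
   exists because the first alternative fails for [c = 0], [gam = 1]. *)
Lemma cone_duality (c : 'rV[R]_n) (b : 'rV[R]_m) (gam : R) :
  (exists l, [/\ N l, l *m J^T = - c & gam <= dotv l b]) \/
  (exists z, (forall l, N l -> dotv l (z *m J + b) <= 0) /\ dotv c z < gam).
Proof.
have normalize z al g : 0 < al ->
    (forall l, N l -> dotv l (z *m J) + al * dotv l b <= 0) -> dotv c z < al * g ->
    exists z, (forall l, N l -> dotv l (z *m J + b) <= 0) /\ dotv c z < g.
  move=> al0 hz hc; exists (al^-1 *: z); split.
    move=> l Nl; rewrite -scalemxAl dotvDr dotvZr -(pmulr_rle0 _ al0).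
    by rewrite mulrDr mulrA mulfV ?gt_eqF // mul1r hz.
  by rewrite dotvZr mulrC ltr_pdivrMr // mulrC.
have [?|[z [al [al0 hz hc]]]] := cone_alternative c b gam; first by left.
right; have [al00|aln] := eqVneq al 0; last first.
  by apply: normalize hz hc; rewrite lt_neqAle eq_sym aln.
rewrite {al}al00 mul0r in al0 hz hc.
have [[l [Nl l0]]|[z1 [al1 [al10 hz1]]]] := cone_alternative 0 b 1.
  rewrite oppr0 in l0; rewrite (Ninj Nl l0) dotv0l; lra.
rewrite dotv0l mulr1 => al1p.
have hc1 : dotv c z1 < al1 * ((dotv c z1 + 1) / al1).
  by rewrite mulrC mulfVK ?gt_eqF // ltrDl.
have [z2 [hz2 _]] := normalize _ _ _ al1p hz1 hc1.
pose M := (`|dotv c z2 - gam| + 1) / - dotv c z.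
have cz : 0 < - dotv c z by lra.
have M0 : 0 < M by rewrite divr_gt0 // ltr_wpDl.
exists (z2 + M *: z); split.
  move=> l Nl; rewrite mulmxDl addrAC dotvDr -scalemxAl dotvZr.
  have := hz2 l Nl; have := hz l Nl; rewrite mul0r addr0 => h1 h2.
  have : M * dotv l (z *m J) <= 0 by rewrite pmulr_rle0.
  lra.
rewrite dotvDr dotvZr.
have : M * - dotv c z = `|dotv c z2 - gam| + 1 by rewrite mulfVK ?gt_eqF.
have := ler_norm (dotv c z2 - gam); lra.
Qed.

End Cone.
End Duality.

(** * Directional metric subregularity and feasible arcs *)

Section Directional.
Variables (R : realType) (n m : nat) (g : 'rV[R]_n -> 'rV[R]_m) (J : 'M[R]_(n, m)).
Variables (K : set 'rV[R]_m) (x d : 'rV[R]_n).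
Hypothesis cK : closed K.
Hypothesis cg : continuous g.
Hypothesis gJ : forall e : R, 0 < e -> exists2 r : R, 0 < r & forall a b,
  eunorm (a - x) < r -> eunorm (b - x) < r ->
  eunorm (g b - g a - (b - a) *m J) <= e * eunorm (b - a).
Hypothesis rcq : forall l, Ndir K (g x) (d *m J) l ->
  (forall h, dotv l (h *m J) = 0) -> l = 0.

(** Uniform form of the constraint qualification: otherwise unit normals with J-images tending to 0
    accumulate at a unit directional normal annihilated by the adjoint, against [rcq]. The negated
    clause bounds the norm of that image by [r] through its action on all [h]. *)
Lemma normal_mulmx_large : exists2 r : R, 0 < r & forall t p l, 0 < t -> t < r ->
  eunorm (p - (g x + t *: (d *m J))) <= r * t -> Fnormal K p l -> eunorm l = 1 ->
  ~ (forall h, - dotv l (h *m J) <= r * eunorm h).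
Proof.
apply: contrapT => hn.
have [|l [Nl l1 hl]] := @Ndir_limit _ _ K (g x) (d *m J)
    (fun r l => forall h, - dotv l (h *m J) <= r * eunorm h).
  move=> r r0; apply: contrapT => hr; apply: hn; exists r => // t p l t0 tr pr Fl l1 hh.
  by apply: hr; exists t, p, l.
suff l0 : l = 0 by move: l1; rewrite l0 eunorm0 => /eqP; rewrite eq_sym oner_eq0.
have le0 h : - dotv l (h *m J) <= 0.
  apply: (@le_small _ _ _ (eunorm h + eunorm (h *m J)) 1) => // t t0 _.
  have [r [l' [r0 rt ll hh]]] := hl t t0.
  have := hh h; have := dotv_le (l' - l) (h *m J); rewrite dotvDl dotvNl.
  have : r * eunorm h <= t * eunorm h by rewrite ler_wpM2r ?eunorm_ge0 // ltW.
  have : eunorm (l' - l) * eunorm (h *m J) <= t * eunorm (h *m J).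
    by rewrite ler_wpM2r ?eunorm_ge0 // ltW.
  lra.
apply: rcq => // h; have := le0 h; have := le0 (- h).
by rewrite mulNmx dotvNr; lra.
Qed.

(** By minimality a move by [t *: h] lowers the distance by at most [eta * t] times |h|. By
    [eunorm_perturb] it changes the distance by at most [t] times the product of the normal with
    [h *m J], plus the linearisation error [e] and a term quadratic in [t]. *)
Lemma penalized_min_stationary (K0 : K !=set0) (r e eta G : R) x1 x' p :
  0 <= e -> 0 <= G -> (forall h, eunorm (h *m J) <= G * eunorm h) ->
  0 < r -> eunorm (x1 - x') <= r / 2 ->
  (forall z, eunorm (z - x') <= r ->
     eunorm (g z - g x1 - (z - x1) *m J) <= e * eunorm (z - x1)) ->
  (forall z, eunorm (z - x') <= r ->
     setdist (g x1) K + eta * eunorm (x1 - x') <= setdist (g z) K + eta * eunorm (z - x')) ->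
  0 <= eta -> K p -> setdist (g x1) K = eunorm (g x1 - p) -> 0 < eunorm (g x1 - p) ->
  forall h, - dotv ((eunorm (g x1 - p))^-1 *: (g x1 - p)) (h *m J)
     <= (e + eta) * eunorm h.
Proof.
move=> e0 G0 hG r0 x1r hst hmin eta0 Kp Dp p0 h.
set a := g x1 - p in p0 *; set nu := _ *: a.
have nu1 : eunorm nu = 1.
  by rewrite eunormZ gtr0_norm ?invr_gt0 // mulVf ?gt_eqF.
have h0 := eunorm_ge0 h.
(* Coefficient of [t ^+ 2] in the remainder of [eunorm_perturb], since the increment of [g] has norm
   at most [t * ((G + e) * eunorm h)]. *)
pose C := ((G + e) * eunorm h) ^+ 2 / (2 * eunorm a).
apply: (@le_small _ _ _ C (r / 2 / (eunorm h + 1))).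
  by rewrite divr_gt0 ?divr_gt0 //; lra.
move=> t t0; rewrite ler_pdivlMr; last lra.
move=> tr.
have zr : eunorm (x1 + t *: h - x') <= r.
  have -> : x1 + t *: h - x' = (x1 - x') + t *: h by vec.
  apply: le_trans (eunormD _ _) _; rewrite eunormZ gtr0_norm //; lra.
pose w := g (x1 + t *: h) - g x1.
have wE : eunorm (w - t *: (h *m J)) <= e * (t * eunorm h).
  have := hst _ zr; rewrite (_ : x1 + t *: h - x1 = t *: h); last by vec.
  rewrite eunormZ gtr0_norm //.
  by rewrite -scalemxAl.
have wle : eunorm w <= t * ((G + e) * eunorm h).
  have := eunormD (w - t *: (h *m J)) (t *: (h *m J)).
  rewrite subrK eunormZ gtr0_norm // => h1.
  have : t * eunorm (h *m J) <= t * (G * eunorm h) by rewrite ler_pM2l.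
  lra.
have hw : eunorm a <= eunorm (a + w) + eta * (t * eunorm h).
  have := hmin _ zr; rewrite Dp -/a.
  have : setdist (g (x1 + t *: h)) K <= eunorm (a + w).
    have -> : a + w = g (x1 + t *: h) - p by rewrite /a /w; vec.
    exact: setdist_le.
  have : eta * eunorm (x1 + t *: h - x') <= eta * (eunorm (x1 - x') + t * eunorm h).
    apply: ler_wpM2l => //.
    have -> : x1 + t *: h - x' = (x1 - x') + t *: h by vec.
    by apply: le_trans (eunormD _ _) _; rewrite eunormZ gtr0_norm.
  lra.
have hp := eunorm_perturb w p0; rewrite -/nu in hp.
have hnu : dotv nu w <= t * dotv nu (h *m J) + e * (t * eunorm h).
  have := dotv_le nu (w - t *: (h *m J)).
  rewrite nu1 mul1r dotvDr dotvNr dotvZr; lra.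
have hC : eunorm w ^+ 2 / (2 * eunorm a) <= t ^+ 2 * C.
  rewrite /C mulrA; apply: ler_wpM2r; first by rewrite invr_ge0; lra.
  rewrite -exprMn lerXn2r ?nnegrE ?eunorm_ge0 // !mulr_ge0 ?(ltW t0) //; lra.
rewrite -(ler_pM2l t0); lra.
Qed.

(** The function [F], distance of [g z] to [K] plus [eta] times |z - x'|, is minimised over the ball
    of radius [c * al] about [x']. Were the minimiser infeasible, stationarity would produce a unit
    normal with small J-image at a point of [K] near the direction, excluded by
    [normal_mulmx_large]. *)
Lemma directional_subregularity : exists2 c : R, 0 < c & exists2 r : R, 0 < r &
  forall t x' q al, 0 < t -> t < r -> eunorm (x' - (x + t *: d)) <= r * t ->
    K q -> 0 < al -> al <= r * t -> eunorm (g x' - q) <= al ->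
    exists2 z, K (g z) & eunorm (z - x') <= c * al.
Proof.
have [r0 r00 hr0] := normal_mulmx_large.
have [G G0 hG] := mulmx_bound J.
have D0 := eunorm_ge0 d; set D := eunorm d in D0.
(* Small enough that the linearisation error over a distance [(1 + D) * t] is at most [r0 / 3 * t],
   and that [e + eta <= r0]. *)
pose e := r0 / (3 * (D + 2)).
have e0 : 0 < e by rewrite divr_gt0 //; lra.
have eE : e * (3 * (D + 2)) = r0 by rewrite mulfVK // gt_eqF //; lra.
have eD0 : 0 <= e * D by rewrite mulr_ge0 // ltW.
have [r1 r10 hr1] := gJ e0.
pose eta := r0 / 2.
have eta0 : 0 < eta by rewrite divr_gt0.
(* As [F x' <= al] and [c * eta = 2], the minimiser lies in the half ball, so it can be moved in
   every direction. *)
pose c := 2 / eta.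
have c0 : 0 < c by rewrite divr_gt0.
have cE : c * eta = 2 by rewrite /c mulfVK ?gt_eqF.
have c1 : 0 < c + 1 by lra.
have G1 : 0 < 3 * (G + 1) by lra.
have D1 : 0 < D + 1 by lra.
have [|s2 s20 /= /and3P[s2a s2G _]] := @pos_mins _ [:: 1; r0 / (3 * (G + 1))].
  by rewrite /= ltr01 divr_gt0.
have [|r rp /= /and4P[ra rD rs2 _]] :=
    @pos_mins _ [:: r0 / 3; r1 / (D + 1); s2 / (c + 1)].
  by rewrite /= !divr_gt0.
rewrite !ler_pdivlMr // in s2G rD rs2.
exists c => //; exists r => // t x' q al t0 tr hx' Kq al0 alr hq.
have K0 : K !=set0 by exists q.
have rt2 : r * (c + 1) * t <= s2 * t by rewrite ler_pM2r.
have near_td z : eunorm (z - x') <= c * al -> eunorm (z - x - t *: d) <= s2 * t.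
  move=> hz; have := eunorm_tri z x' (x + t *: d); rewrite opprD addrA => h.
  have : c * al <= c * (r * t) by rewrite ler_pM2l.
  move: hx' h; rewrite opprD addrA; lra.
have near_x z : eunorm (z - x') <= c * al -> eunorm (z - x) <= (1 + D) * t.
  move=> /near_td hz; have := eunormD (z - x - t *: d) (t *: d).
  rewrite subrK eunormZ gtr0_norm // -/D => h.
  have : s2 * t <= 1 * t by rewrite ler_pM2r.
  lra.
have near_r1 z : eunorm (z - x') <= c * al -> eunorm (z - x) < r1.
  move=> /near_x hz; apply: le_lt_trans hz _; apply: lt_le_trans rD.
  rewrite addrC mulrC ltr_pM2r //.
pose F z := setdist (g z) K + eta * eunorm (z - x').
have cF : continuous F.
  apply: continuous_eunorm => z e' e'0.
  have e'2 : 0 < e' / 2 by rewrite divr_gt0.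
  have [ra1 ra10 hra1] := continuous_eps e'2 (@cg z).
  have [ra2 [ra20 ra21 ra22]] := pos_min ra10 (divr_gt0 e'2 eta0).
  exists ra2 => // z' hz'.
  have h1 := hra1 z' (lt_le_trans hz' ra21).
  have h2 := setdist_lip (g z') (g z) K0.
  have h3 := eunorm_lip z' z x'.
  have h4 : eta * eunorm (z' - z) < e' / 2.
    by rewrite mulrC -ltr_pdivlMr //; exact: lt_le_trans hz' ra22.
  have h5 : `|eta * eunorm (z' - x') - eta * eunorm (z - x')| <= eta * eunorm (z' - z).
    by rewrite -mulrBr normrM (gtr0_norm eta0) ler_pM2l.
  have -> : F z' - F z = (setdist (g z') K - setdist (g z) K)
     + (eta * eunorm (z' - x') - eta * eunorm (z - x')) by rewrite /F; ring.
  apply: le_lt_trans (ler_normD _ _) _; lra.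
have cal0 : 0 < c * al by rewrite mulr_gt0.
have x'0 : eunorm (x' - x') <= c * al by rewrite subrr eunorm0 ltW.
have [x1 [_ x1r hmin]] := eball_min closedT cF (I : setT x') x'0.
have Fx1 : F x1 <= al.
  apply: le_trans (hmin x' I x'0) _; rewrite /F subrr eunorm0 mulr0 addr0.
  by apply: le_trans hq; exact: setdist_le.
have sd0 := setdist_ge0 (g x1) K0.
have x1x' : eunorm (x1 - x') <= c * al / 2.
  have : eta * eunorm (x1 - x') <= al by move: Fx1; rewrite /F; lra.
  rewrite -(ler_pM2l c0) mulrA cE; lra.
have sdal : setdist (g x1) K <= al.
  have : 0 <= eta * eunorm (x1 - x') by rewrite mulr_ge0 ?eunorm_ge0 // ltW.
  by move: Fx1; rewrite /F; lra.
have [p Kp Dp] := nearest_point (g x1) cK K0.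
have [Dp0|Dpn] := eqVneq (eunorm (g x1 - p)) 0.
  exists x1 => //; have -> : g x1 = p by apply/eqP; rewrite -subr_eq0 (eunorm_eq0 Dp0).
  exact: Kp.
have p0 : 0 < eunorm (g x1 - p) by rewrite lt_neqAle eq_sym Dpn eunorm_ge0.
exfalso; apply: (hr0 t p ((eunorm (g x1 - p))^-1 *: (g x1 - p))) => //.
- lra.
- have h1 : eunorm (p - g x1) <= r0 / 3 * t.
    rewrite eunormB -Dp; apply: le_trans sdal _; apply: le_trans alr _.
    rewrite ler_pM2r //; lra.
  have h2 : eunorm (g x1 - g x - (x1 - x) *m J) <= r0 / 3 * t.
    apply: le_trans (hr1 _ _ _ (near_r1 _ x1r)) _.
      by rewrite subrr eunorm0.
    apply: (@le_trans _ _ (e * ((1 + D) * t))).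
      by rewrite ler_pM2l //; exact: near_x.
    rewrite mulrA ler_pM2r //; lra.
  have h3 : eunorm ((x1 - x - t *: d) *m J) <= r0 / 3 * t.
    apply: le_trans (hG _) _; apply: (@le_trans _ _ (G * (s2 * t))).
      by rewrite ler_pM2l //; exact: near_td.
    rewrite mulrA ler_pM2r //.
    have : 0 <= s2 * G by rewrite mulr_ge0 // ltW.
    lra.
  have -> : p - (g x + t *: (d *m J)) = (p - g x1) +
     ((g x1 - g x - (x1 - x) *m J) + (x1 - x - t *: d) *m J).
    rewrite [(x1 - x - t *: d) *m J]mulmxBl -scalemxAl.
    move: ((x1 - x) *m J) (d *m J) => P Q; vec.
  apply: le_trans (eunormD _ _) _.
  have := eunormD (g x1 - g x - (x1 - x) *m J) ((x1 - x - t *: d) *m J).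
  lra.
- apply: nearest_Fnormal => // z Kz; rewrite -Dp; exact: setdist_le.
- by rewrite eunormZ gtr0_norm ?invr_gt0 // mulVf ?gt_eqF.
- move=> h; apply: le_trans (_ : (e + eta) * eunorm h <= _); last first.
    by apply: ler_wpM2r; [exact: eunorm_ge0|rewrite /eta; lra].
  apply: (@penalized_min_stationary K0 (c * al) e eta G x1 x' p) => //; try exact: ltW.
  + move=> z hz; apply: hr1; exact: near_r1.
  + by move=> z hz; exact: hmin.
Qed.

(** The point [y'] of [K] moved by [s *: v] stays within [e1 * s] of [K] by [clarke_tangent], and it
    agrees with the image of [x + t *: d + s *: z] up to errors of order [s]; subregularity then
    corrects [z]. The term [s *: b] is the curvature of [g] along [d]: [Hg] when [s] is half of
    [t ^+ 2], and 0 in the asymptotic case. *)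
Lemma feasible_arc (b w : 'rV[R]_m) (z : 'rV[R]_n) (e : R) : 0 < e ->
  (forall l, Ndir K (g x) (d *m J) l -> dotv l (z *m J + (b - w)) <= 0) ->
  exists2 r : R, 0 < r & forall t s w', 0 < t -> t < r -> 0 < s -> s <= r * t ->
    eunorm (w' - w) <= r ->
    eunorm (g (x + t *: d) - (g x + t *: (d *m J) + s *: b)) <= r * s ->
    K (g x + t *: (d *m J) + s *: w') ->
    exists2 z', eunorm (z' - z) <= e & K (g (x + t *: d + s *: z')).
Proof.
move=> e0 hv; set v := z *m J + (b - w) in hv.
have [c c0 [rS rS0 hS]] := directional_subregularity.
(* Four errors of size [e1 * s] add up: linearisation of [g], its expansion along [d], the gap
   between [w] and [w'], and the distance to [K]. *)
pose e1 := e / (4 * c).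
have e10 : 0 < e1 by rewrite divr_gt0 // mulr_gt0.
have e1E : c * (4 * e1) = e by rewrite /e1; field; rewrite gt_eqF.
have [rC rC0 hC] := clarke_tangent hv cK e10.
have Z0 := eunorm_ge0 z; have W0 := eunorm_ge0 w; have D0 := eunorm_ge0 d.
have Z1 : 0 < eunorm z + 1 by lra.
have [rJ rJ0 hJ] := gJ (divr_gt0 e10 Z1).
have W1 : 0 < eunorm w + 1 by lra.
have S1 : 0 < eunorm z + 4 * e1 by lra.
have DZ : 0 < eunorm d + eunorm z + 1 by lra.
have [|r r0 /= /and5P[r_1 re1 r_C r_S /and4P[rW rZ rD _]]] := @pos_mins _
    [:: 1; e1; rC; rS; rC / (eunorm w + 1); rS / (eunorm z + 4 * e1);
        rJ / (eunorm d + eunorm z + 1)].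
  by rewrite /= ltr01 e10 rC0 rS0 !divr_gt0.
rewrite !ler_pdivlMr // in rW rZ rD.
exists r => // t s w' t0 tr s0 sr ww hg Kw.
have rWt : r * (eunorm w + 1) * t <= rC * t by rewrite ler_pM2r.
have rZt : r * (eunorm z + 4 * e1) * t <= rS * t by rewrite ler_pM2r.
have st : s <= t by apply: le_trans sr _; rewrite ler_piMl // ltW.
pose y' := g x + t *: (d *m J) + s *: w'; pose x' := x + t *: d + s *: z.
have hq : setdist (y' + s *: v) K <= e1 * s.
  apply: (hC t) => //; first exact: lt_le_trans tr r_C.
  - by apply: le_trans sr _; rewrite ler_pM2r.
  - rewrite /y' addrAC subrr add0r eunormZ gtr0_norm //.
    have w'1 : eunorm w' <= eunorm w + 1.
      have := eunormD (w' - w) w; rewrite subrK; lra.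
    apply: (@le_trans _ _ (s * (eunorm w + 1))); first by rewrite ler_pM2l.
    apply: (@le_trans _ _ (r * t * (eunorm w + 1))); first by rewrite ler_pM2r.
    lra.
have K0 : K !=set0 by exists y'.
have [q Kq Dq] := nearest_point (y' + s *: v) cK K0.
have tD : t * (eunorm d + eunorm z + 1) < rJ.
  by apply: lt_le_trans rD; rewrite ltr_pM2r.
have sz : s * eunorm z <= t * eunorm z by rewrite ler_wpM2r.
have h1 : eunorm (g x' - g (x + t *: d) - s *: (z *m J)) <= e1 * s.
  have := hJ (x + t *: d) x'.
  have -> : x + t *: d - x = t *: d by vec.
  have -> : x' - (x + t *: d) = s *: z by rewrite /x'; vec.
  have xx : eunorm (x' - x) <= t * eunorm d + s * eunorm z.
    have -> : x' - x = t *: d + s *: z by rewrite /x'; vec.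
    by apply: le_trans (eunormD _ _) _; rewrite !eunormZ !gtr0_norm.
  have tz : 0 <= t * eunorm z by rewrite mulr_ge0 // ltW.
  rewrite !eunormZ !gtr0_norm // -scalemxAl => h; apply: le_trans (h _ _) _.
  - lra.
  - lra.
  - have -> : e1 / (eunorm z + 1) * (s * eunorm z) =
        e1 * s * (eunorm z / (eunorm z + 1)) by ring.
    apply: ler_piMr; first by apply: mulr_ge0; exact: ltW.
    rewrite ler_pdivrMr //; lra.
have hgq : eunorm (g x' - q) <= 4 * e1 * s.
  have h2 : eunorm (s *: (w - w')) <= e1 * s.
    rewrite eunormZ gtr0_norm // eunormB mulrC ler_pM2r //; exact: le_trans ww re1.
  have h3 : r * s <= e1 * s by rewrite ler_pM2r.
  have -> : g x' - q = (g x' - g (x + t *: d) - s *: (z *m J)) +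
     ((g (x + t *: d) - (g x + t *: (d *m J) + s *: b)) +
      (s *: (w - w') + (y' + s *: v - q))).
    rewrite /y' /v; move: (z *m J) (d *m J) (g x') (g (x + t *: d)) => ? ? ? ?; vec.
  apply: le_trans (eunormD _ _) _.
  have := eunormD (g (x + t *: d) - (g x + t *: (d *m J) + s *: b))
      (s *: (w - w') + (y' + s *: v - q)).
  have := eunormD (s *: (w - w')) (y' + s *: v - q).
  rewrite -Dq; lra.
have [||||x2 Kx2 hx2] := hS t x' q (4 * e1 * s) t0 _ _ Kq _ _ hgq.
- exact: lt_le_trans tr r_S.
- have -> : x' - (x + t *: d) = s *: z by rewrite /x'; vec.
  rewrite eunormZ gtr0_norm //.
  have : s * eunorm z <= r * t * eunorm z by rewrite ler_wpM2r.
  have : 0 <= r * t * e1 by apply: mulr_ge0 => //; [apply: mulr_ge0|]; exact: ltW.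
  lra.
- by apply: mulr_gt0 => //; exact: mulr_gt0.
- have : s * (4 * e1) <= r * t * (4 * e1) by rewrite ler_wpM2r //; lra.
  have : 0 <= r * t * eunorm z by apply: mulr_ge0 => //; apply: mulr_ge0; exact: ltW.
  lra.
have sn : s != 0 by rewrite gt_eqF.
exists (s^-1 *: (x2 - (x + t *: d))).
  have -> : s^-1 *: (x2 - (x + t *: d)) - z = s^-1 *: (x2 - x').
    have -> : x2 - x' = x2 - (x + t *: d) - s *: z by rewrite /x'; vec.
    by rewrite [RHS]scalerBr scalerA mulVf // scale1r.
  rewrite eunormZ gtr0_norm ?invr_gt0 // mulrC ler_pdivrMr //.
  by apply: le_trans hx2 _; rewrite mulrA e1E.
by rewrite scalerA mulfV // scale1r addrCA subrr addr0.
Qed.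

(** * The objective along feasible arcs *)

Variables (f : 'rV[R]_n -> R) (c : 'rV[R]_n) (Hf : R) (Hg : 'rV[R]_m).
Hypothesis fc : forall e : R, 0 < e -> exists2 r : R, 0 < r & forall a b,
  eunorm (a - x) < r -> eunorm (b - x) < r ->
  `|f b - f a - dotv c (b - a)| <= e * eunorm (b - a).
Hypothesis f2 : forall e : R, 0 < e -> exists2 r : R, 0 < r & forall t, 0 < t -> t < r ->
  `|f (x + t *: d) - (f x + t * dotv c d + 2^-1 * t ^+ 2 * Hf)| <= e * t ^+ 2.
Hypothesis g2 : forall e : R, 0 < e -> exists2 r : R, 0 < r & forall t, 0 < t -> t < r ->
  eunorm (g (x + t *: d) - (g x + t *: (d *m J) + (2^-1 * t ^+ 2) *: Hg))
    <= e * t ^+ 2.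
Hypothesis cd : dotv c d <= 0.

Lemma objective_arc (z : 'rV[R]_n) (e : R) : 0 < e -> exists2 r : R, 0 < r &
  forall t s z', 0 < t -> t < r -> 0 < s -> s <= r * t -> eunorm (z' - z) <= r ->
  f (x + t *: d + s *: z') <=
    f x + 2^-1 * t ^+ 2 * Hf + s * dotv c z + e * t ^+ 2 + e * s.
Proof.
move=> e0; have e2 : 0 < e / 2 by rewrite divr_gt0.
have Z0 := eunorm_ge0 z; have D0 := eunorm_ge0 d; have C0 := eunorm_ge0 c.
have Z1 : 0 < eunorm z + 1 by lra.
have C1 : 0 < eunorm c + 1 by lra.
have DZ : 0 < eunorm d + eunorm z + 1 by lra.
have [rf rf0 hf] := fc (divr_gt0 e2 Z1).
have [r2 r20 h2] := f2 e0.
have [|r r0 /= /and5P[r_1 r_2 rD rc _]] := @pos_mins _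
    [:: 1; r2; rf / (eunorm d + eunorm z + 1); e / 2 / (eunorm c + 1)].
  by rewrite /= ltr01 r20 divr_gt0 ?divr_gt0.
rewrite !ler_pdivlMr // in rD rc.
exists r => // t s z' t0 tr s0 sr hz.
have st : s <= t by apply: le_trans sr _; rewrite ler_piMl // ltW.
have z'1 : eunorm z' <= eunorm z + 1 by have := eunormD (z' - z) z; rewrite subrK; lra.
have tD : t * (eunorm d + eunorm z + 1) < rf.
  by apply: lt_le_trans rD; rewrite ltr_pM2r.
have sz : s * eunorm z' <= t * (eunorm z + 1).
  by apply: ler_pM => //; [exact: ltW|exact: eunorm_ge0].
have h1 : f (x + t *: d + s *: z') - f (x + t *: d) - s * dotv c z' <= e / 2 * s.
  have := hf (x + t *: d) (x + t *: d + s *: z').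
  have -> : x + t *: d - x = t *: d by vec.
  have -> : x + t *: d + s *: z' - (x + t *: d) = s *: z' by vec.
  have xx : eunorm (x + t *: d + s *: z' - x) <= t * eunorm d + s * eunorm z'.
    have -> : x + t *: d + s *: z' - x = t *: d + s *: z' by vec.
    by apply: le_trans (eunormD _ _) _; rewrite !eunormZ !gtr0_norm.
  have tz : 0 <= t * (eunorm z + 1) by rewrite mulr_ge0 // ltW.
  rewrite !eunormZ (gtr0_norm s0) (gtr0_norm t0) dotvZr => h.
  apply: le_trans (ler_norm _) _; apply: le_trans (h _ _) _.
  - lra.
  - lra.
  - have -> : e / 2 / (eunorm z + 1) * (s * eunorm z') =
        e / 2 * s * (eunorm z' / (eunorm z + 1)) by ring.
    apply: ler_piMr; first by apply: mulr_ge0; exact: ltW.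
    rewrite ler_pdivrMr //; lra.
have h3 : dotv c z' <= dotv c z + e / 2.
  have := dotv_le c (z' - z); rewrite dotvDr dotvNr.
  have : eunorm c * eunorm (z' - z) <= eunorm c * r by rewrite ler_wpM2l.
  lra.
have h4 : s * dotv c z' <= s * (dotv c z + e / 2) by rewrite ler_pM2l.
have h5 : t * dotv c d <= 0 by rewrite pmulr_rle0.
have := h2 t t0 (lt_le_trans tr r_2); rewrite ler_norml => /andP[_ h6].
lra.
Qed.

(** With [s] equal to half of [t * q] and t/q tending to 0, every term of order [t ^+ 2] is
    negligible against [s]. The feasible arc then changes the objective by about [s * dotv c z],
    which cannot be negative. *)
Lemma no_asymptotic_descent (v : 'rV[R]_m) (z : 'rV[R]_n) :
  (forall x', K (g x') -> f x <= f x') -> T2asym K (g x) (d *m J) v ->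
  (forall l, Ndir K (g x) (d *m J) l -> dotv l (z *m J - v) <= 0) ->
  0 <= dotv c z.
Proof.
move=> opt Tv hz; rewrite leNgt; apply/negP => cz.
have e0 : 0 < - dotv c z / 4 by rewrite divr_gt0 // oppr_gt0.
set e := - dotv c z / 4 in e0.
have [r1 r10 h1] := objective_arc z e0.
have hz' l : Ndir K (g x) (d *m J) l -> dotv l (z *m J + (0 - v)) <= 0.
  by rewrite sub0r; exact: hz.
have [r2 r20 h2] := feasible_arc r10 hz'.
have [r3 r30 h3] := g2 ltr01.
have H0 := eunorm_ge0 Hg.
have H1 : 0 < eunorm Hg + 2 by lra.
have F0 := normr_ge0 Hf.
have F1 : 0 < `|Hf| + 2 * e by lra.
(* Since [t ^+ 2 <= 2 * r * s], the fourth bound absorbs the curvature of [g] into [r2 * s], and the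
   fifth that of the objective into [e * s]. *)
have [|r r0 /= /and5P[r_1 r_2 r_3 rH /andP[rF _]]] := @pos_mins _
    [:: r1; r2; r3; r2 / (eunorm Hg + 2); e / (`|Hf| + 2 * e)].
  by rewrite /= r10 r20 r30 (divr_gt0 r20 H1) (divr_gt0 e0 F1).
rewrite ler_pdivlMr // in rH; rewrite ler_pdivlMr // in rF.
have [t [q [w [[t0 tr q0 qr] [tq ww Kw]]]]] := T2asym_eps Tv r0.
pose s := 2^-1 * t * q.
have s0 : 0 < s by rewrite /s !mulr_gt0 // invr_gt0.
have t2s : t ^+ 2 <= 2 * r * s.
  have : t * t <= t * (r * q) by rewrite ler_pM2l // ltW.
  rewrite /s; lra.
have srt : s <= r * t.
  have : t * q <= t * r by rewrite ler_pM2l // ltW.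
  have : 0 < t * r by rewrite mulr_gt0.
  rewrite /s; lra.
have rt a : r <= a -> s <= a * t.
  by move=> ra; apply: le_trans srt _; rewrite ler_pM2r.
have [||||z' zz Kz'] := h2 t s w t0 _ s0 _ _ _ Kw.
- exact: lt_le_trans tr r_2.
- exact: rt.
- exact: ltW (lt_le_trans ww r_2).
- rewrite scaler0 addr0.
  have -> : g (x + t *: d) - (g x + t *: (d *m J)) =
     (g (x + t *: d) - (g x + t *: (d *m J) + (2^-1 * t ^+ 2) *: Hg))
      + (2^-1 * t ^+ 2) *: Hg.
    move: (d *m J) (g (x + t *: d)) => ? ?; vec.
  apply: le_trans (eunormD _ _) _; rewrite eunormZ ger0_norm; last first.
    by rewrite mulr_ge0 ?sqr_ge0 // invr_ge0.
  have := h3 t t0 (lt_le_trans tr r_3).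
  have a1 : t ^+ 2 * (eunorm Hg + 2) <= 2 * r * s * (eunorm Hg + 2).
    by rewrite ler_pM2r.
  have a2 : r * (eunorm Hg + 2) * s <= r2 * s by rewrite ler_pM2r.
  lra.
have := h1 t s z' t0 (lt_le_trans tr r_1) s0 (rt _ r_1) zz.
have := opt _ Kz'.
have b1 : t ^+ 2 * Hf <= t ^+ 2 * `|Hf|.
  by apply: ler_wpM2l; [exact: sqr_ge0|exact: ler_norm].
have b2 : t ^+ 2 * (`|Hf| + 2 * e) <= 2 * r * s * (`|Hf| + 2 * e) by rewrite ler_pM2r.
have b3 : r * (`|Hf| + 2 * e) * s <= e * s by rewrite ler_pM2r.
have b4 : s * dotv c z = - 4 * (e * s) by rewrite /e; field.
have b5 : 0 < e * s by rewrite mulr_gt0.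
rewrite b4; lra.
Qed.

(** If the inequality failed, growth along the arc would place a point of [S] within [t * (D - eta)]
    of [x + t *: d], up to order [t ^+ 2]. The quotients of these points would then have a tangent
    limit closer to [d] than [D]. *)
Lemma second_order_growth (S : set 'rV[R]_n) (kappa rho : R) (w : 'rV[R]_m)
    (z : 'rV[R]_n) :
  S x -> 0 < kappa -> 0 < rho ->
  (forall x', K (g x') -> eunorm (x' - x) < rho ->
     f x + kappa * setdist x' S ^+ 2 <= f x') ->
  T2set K (g x) (d *m J) w ->
  (forall l, Ndir K (g x) (d *m J) l -> dotv l (z *m J + (Hg - w)) <= 0) ->
  2 * kappa * setdist d (Tcone S x) ^+ 2 <= Hf + dotv c z.
Proof.
move=> Sx k0 rho0 growth Tw hz; rewrite leNgt; apply/negP.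
set D := setdist _ _ => gapp.
have S0 : S !=set0 by exists x.
have T0 : Tcone S x !=set0 by exists 0; exact: Tcone0.
have D0 : 0 <= D := setdist_ge0 d T0.
pose gap := 2 * kappa * D ^+ 2 - (Hf + dotv c z).
have gap0 : 0 < gap by rewrite subr_gt0.
pose e := gap / 6.
have e0 : 0 < e by rewrite divr_gt0.
(* With [e = gap / 6], the objective bound is half of [t ^+ 2] times [Hf + dotv c z + 3 * e], which
   equals [kappa * t ^+ 2 * (D ^+ 2 - q)]. *)
pose q := gap / (4 * kappa).
have q0 : 0 < q by rewrite divr_gt0 // mulr_gt0.
have qE : kappa * q = gap / 4 by rewrite /q; field; rewrite gt_eqF.
have [r1 r10 h1] := objective_arc z e0.
have [rz [rz0 rz1 rz2]] := pos_min r10 ltr01.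
have [r2 r20 h2] := feasible_arc rz0 hz.
have [r3 r30 h3] := g2 (divr_gt0 r20 (ltr0n R 2)).
have d0 := eunorm_ge0 d; have z0 := eunorm_ge0 z.
have DZ : 0 < eunorm d + eunorm z + 1 by lra.
have near r0 : 0 < r0 -> exists t x', [/\ 0 < t, t < r0,
    eunorm (x' - (x + t *: d)) <= t ^+ 2 * (eunorm z + 1) &
    setdist x' S ^+ 2 <= t ^+ 2 * (D ^+ 2 - q)].
  move=> r00.
  have [|r r0' /= /and5P[r_1 r_2 r_3 rD /and3P[r_0 r_o _]]] := @pos_mins _
      [:: r1; r2; r3; rho / (eunorm d + eunorm z + 1); r0; 1].
    by rewrite /= r10 r20 r30 r00 ltr01 (divr_gt0 rho0 DZ).
  rewrite ler_pdivlMr // in rD.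
  have [t [w' [t0 tr ww Kw]]] := T2set_eps Tw r0'.
  pose s := 2^-1 * t ^+ 2.
  have t2 : 0 < t ^+ 2 by rewrite exprn_gt0.
  have s0 : 0 < s by rewrite /s mulr_gt0 // invr_gt0.
  have t2r : t * t <= t * r by rewrite ler_pM2l // ltW.
  have srt a : r <= a -> s <= a * t.
    move=> ra; have : t * r <= t * a by rewrite ler_pM2l.
    rewrite /s; lra.
  have [||||z' zz Kz'] := h2 t s w' t0 _ s0 _ _ _ Kw.
  - exact: lt_le_trans tr r_2.
  - exact: srt.
  - exact: ltW (lt_le_trans ww r_2).
  - have := h3 t t0 (lt_le_trans tr r_3); rewrite -/s => h; apply: le_trans h _.
    by rewrite /s; lra.
  have z'1 : eunorm z' <= eunorm z + 1.
    have := eunormD (z' - z) z; rewrite subrK; lra.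
  have sz' : s * eunorm z' <= t ^+ 2 * (eunorm z + 1).
    apply: ler_pM => //; [exact: ltW|exact: eunorm_ge0|rewrite /s; lra].
  exists t, (x + t *: d + s *: z'); split => //.
      exact: lt_le_trans tr r_0.
    have -> : x + t *: d + s *: z' - (x + t *: d) = s *: z' by vec.
    by rewrite eunormZ gtr0_norm.
  have xrho : eunorm (x + t *: d + s *: z' - x) < rho.
    have -> : x + t *: d + s *: z' - x = t *: d + s *: z' by vec.
    apply: le_lt_trans (eunormD _ _) _; rewrite !eunormZ !gtr0_norm //.
    apply: lt_le_trans rD.
    have : t ^+ 2 * (eunorm z + 1) <= t * (eunorm z + 1).
      rewrite ler_pM2r ?expr2 //; last lra.
      by rewrite ler_piMl ?(ltW t0) //; lra.
    have : t * (eunorm d + eunorm z + 1) < r * (eunorm d + eunorm z + 1).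
      by rewrite ltr_pM2r.
    lra.
  have a2 := growth _ Kz' xrho.
  have a1 := h1 t s z' t0 (lt_le_trans tr r_1) s0 (srt _ r_1) (le_trans zz rz1).
  rewrite -(ler_pM2l k0); apply: le_trans (_ : 2^-1 * t ^+ 2 * (Hf + dotv c z + 3 * e) <= _).
    move: a1 a2; rewrite /s; lra.
  have -> : kappa * (t ^+ 2 * (D ^+ 2 - q)) = t ^+ 2 * (kappa * D ^+ 2 - kappa * q) by ring.
  rewrite qE mulrAC mulrC ler_pM2l // /e /gap; lra.
(* For [D = 0] the bound on the squared distance is already negative. *)
have [D00|Dn] := eqVneq D 0.
  have [t [x' [t0 _ _]]] := near 1 ltr01; rewrite D00 expr0n /= sub0r => h.
  have : 0 < t ^+ 2 * q by rewrite mulr_gt0 // exprn_gt0.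
  have := sqr_ge0 (setdist x' S); lra.
have Dp : 0 < D by rewrite lt_neqAle eq_sym Dn.
(* Then (D - eta)^2 exceeds D^2 - q, so the distance from [x'] to [S] is below [t * (D - eta)]. *)
have [eta [eta0 etaD etaq]] := pos_min Dp (divr_gt0 q0 (mulr_gt0 (ltr0n R 2) Dp)).
have {}etaq : eta * (2 * D) <= q by rewrite -ler_pdivlMr // mulr_gt0.
have [|d1 Td1 d1M] := @Tcone_limit _ _ S x d (D - eta / 2); last first.
  have : D <= eunorm (d - d1) by exact: setdist_le.
  rewrite eunormB; lra.
move=> r0 r00.
have z2 : 0 < 2 * (eunorm z + 1) by lra.
(* Makes the deviation of the arc from [x + t *: d] at most half of [t * eta], which leaves the
   margin [eta / 2]. *)
have [r [rp rr0 rz']] := pos_min r00 (divr_gt0 eta0 z2).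
have {}rz' : r * (2 * (eunorm z + 1)) <= eta by rewrite -ler_pdivlMr.
have [t [x' [t0 tr hx' hS]]] := near r rp.
have [|a Sa ax] := @setdist_near _ _ x' (t * (D - eta)) S S0.
  rewrite ltNge; apply/negP => h.
  have : (t * (D - eta)) ^+ 2 <= setdist x' S ^+ 2.
    rewrite lerXn2r ?nnegrE //; last exact: setdist_ge0.
    by rewrite mulr_ge0 ?(ltW t0) // subr_ge0.
  have t2 : 0 < t ^+ 2 by rewrite exprn_gt0.
  rewrite exprMn => /le_trans /(_ hS).
  rewrite ler_pM2l //; have : 0 < eta ^+ 2 by rewrite exprn_gt0.
  lra.
exists t, (t^-1 *: (a - x)); split => //; first lra; last first.
  by rewrite scalerA mulfV ?gt_eqF // scale1r addrCA subrr addr0.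
have -> : t^-1 *: (a - x) - d = t^-1 *: ((a - x') + (x' - (x + t *: d))).
  have -> : (a - x') + (x' - (x + t *: d)) = a - x - t *: d by vec.
  by rewrite [RHS]scalerBr scalerA mulVf ?gt_eqF // scale1r.
rewrite eunormZ gtr0_norm ?invr_gt0 // mulrC ler_pdivrMr //.
apply: le_trans (eunormD _ _) _; rewrite (eunormB a).
have : t * (t * (2 * (eunorm z + 1))) <= t * eta.
  rewrite ler_pM2l //; apply: le_trans rz'; rewrite ler_pM2r //; exact: ltW.
lra.
Qed.

End Directional.

(** * Optimality conditions *)

Section Conditions.
Variables (R : realType) (n m : nat).
Variables (f : 'rV[R]_n -> 'rV[R]_1) (g : 'rV[R]_n -> 'rV[R]_m) (K : set 'rV[R]_m).
Variables (x d : 'rV[R]_n).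
Hypotheses (f_C2 : C2 f) (g_C2 : C2 g) (cK : closed K).
Hypotheses (xS : Sol f g K x) (dC : Ccone f g K x d) (rcq : DirRCQ g K x d).

Let J := jacobian g x.
Let c : 'rV[R]_n := (jacobian f x)^T.

Lemma gradE k l (F : 'rV[R]_k -> 'rV[R]_l) (y h : 'rV[R]_k) :
  grad F y h = h *m jacobian F y.
Proof. by rewrite /jacobian mul_rV_lin1. Qed.

Lemma grad_dotv h : grad f x h 0 0 = dotv c h.
Proof.
rewrite gradE /c; move: (jacobian f x) => A.
by rewrite mxE /dotv; apply: eq_bigr => i _; rewrite mxE mulrC.
Qed.

Lemma C2_strict_jacobian k l (F : 'rV[R]_k -> 'rV[R]_l) (y : 'rV[R]_k) (e : R) :
  C2 F -> 0 < e -> exists2 r : R, 0 < r & forall a b,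
  eunorm (a - y) < r -> eunorm (b - y) < r ->
  eunorm (F b - F a - (b - a) *m jacobian F y) <= e * eunorm (b - a).
Proof.
move=> hF e0; have [r r0 hr] := C2_strict_diff y hF e0; exists r => // a b ay b_y.
by rewrite -gradE; exact: hr.
Qed.

Lemma C2_second_order_jacobian k l (F : 'rV[R]_k -> 'rV[R]_l) (y h : 'rV[R]_k) (e : R) :
  C2 F -> 0 < e -> exists2 r : R, 0 < r & forall t, 0 < t -> t < r ->
  eunorm (F (y + t *: h) - (F y + t *: (h *m jacobian F y)
    + (2^-1 * t ^+ 2) *: hess2 F y h)) <= e * t ^+ 2.
Proof.
move=> hF e0; have [r r0 hr] := C2_second_order y h hF e0; exists r => // t t0 tr.
by rewrite -gradE; exact: hr.
Qed.

Lemma fval_strict (e : R) : 0 < e -> exists2 r : R, 0 < r & forall a b,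
  eunorm (a - x) < r -> eunorm (b - x) < r ->
  `|fval f b - fval f a - dotv c (b - a)| <= e * eunorm (b - a).
Proof.
move=> e0; have [r r0 hr] := C2_strict_jacobian x f_C2 e0; exists r => // a b ax bx.
apply: le_trans (hr a b ax bx); rewrite -grad_dotv gradE.
move: (_ *m _) => A; have := coord_le_eunorm (f b - f a - A) 0.
by rewrite !mxE.
Qed.

Lemma fval_second_order (e : R) : 0 < e -> exists2 r : R, 0 < r &
  forall t, 0 < t -> t < r ->
  `|fval f (x + t *: d) - (fval f x + t * dotv c d + 2^-1 * t ^+ 2 * hess2 f x d 0 0)|
    <= e * t ^+ 2.
Proof.
move=> e0; have [r r0 hr] := C2_second_order_jacobian x d f_C2 e0.
exists r => // t t0 tr; apply: le_trans (hr t t0 tr); rewrite -grad_dotv gradE.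
move: (_ *m _) (hess2 f x d) => A H.
have := coord_le_eunorm (f (x + t *: d) - (f x + t *: A + (2^-1 * t ^+ 2) *: H)) 0.
by rewrite !mxE.
Qed.

Lemma C2_continuous k l (F : 'rV[R]_k -> 'rV[R]_l) : C2 F -> continuous F.
Proof. by move=> [dF _] y; exact: differentiable_continuous. Qed.

Lemma rcq_jacobian l : Ndir K (g x) (d *m J) l ->
  (forall h, dotv l (h *m J) = 0) -> l = 0.
Proof.
move=> Nl hl; apply: rcq; first by rewrite gradE; exact: NCdir_sub.
by move=> h; rewrite gradE.
Qed.

Lemma critical_le0 : dotv c d <= 0.
Proof. by rewrite -grad_dotv; case: dC. Qed.

(** DirRCQ is exactly injectivity of the adjoint on the Clarke cone, as [cone_duality] requires.
    Polarity is kept only for the limiting normals, which is what the arc lemmas take. *)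
Lemma multiplier_duality (b : 'rV[R]_m) (gam : R) :
  (exists2 l, Lambdac f g K x d l & gam <= dotv l b) \/
  (exists z, (forall l, Ndir K (g x) (d *m J) l -> dotv l (z *m J + b) <= 0) /\
     dotv c z < gam).
Proof.
have [|||||[l [Nl lJ hl]]|[z [hz hc]]] :=
    @cone_duality R n m J (NCdir K (g x) (d *m J)) _ _ _ _ _ c b gam.
- exact: closed_closure.
- by apply: NCdir_sub; apply: Ndir0; rewrite -gradE; case: dC.
- by move=> u v; exact: NCdirD.
- by move=> a v; exact: NCdirZ.
- move=> l Nl lJ; apply: rcq; first by rewrite gradE.
  by move=> h; rewrite gradE dotv_mulmx lJ dotv0l.
- left; exists l => //; split; last by rewrite gradE.
  by move=> h; rewrite grad_dotv gradE dotv_mulmx lJ dotvNl subrr.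
- by right; exists z; split => // l Nl; apply: hz; exact: NCdir_sub.
Qed.

Lemma prop_i_holds : prop_i f g K x d.
Proof.
move=> v; rewrite gradE -/J => Tv.
have [[l Ll hl]|[z [hz hc]]] := multiplier_duality (- v) 0.
  by exists l; split => //; move: hl; rewrite dotvNr oppr_ge0.
suff : 0 <= dotv c z by rewrite leNgt hc.
apply: (no_asymptotic_descent cK (C2_continuous g_C2)
  (fun e => @C2_strict_jacobian _ _ g x e g_C2) rcq_jacobian
  fval_strict fval_second_order
  (fun e => @C2_second_order_jacobian _ _ g x d e g_C2) critical_le0 _ Tv hz).
by move=> x' Kx'; case: xS => _; apply.
Qed.

(** Duality is applied with the constant Hessian part of the objective moved into [gam], so its
    second alternative is precisely what [second_order_growth] refutes. *)
Lemma prop_ii_holds (kappa rho : R) : 0 < kappa -> 0 < rho ->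
  (forall x', Phi g K x' -> eunorm (x' - x) < rho ->
     fval f x + kappa * setdist x' (Sol f g K) ^+ 2 <= fval f x') ->
  prop_ii f g K x d (2 * kappa * setdist d (Tcone (Sol f g K) x) ^+ 2).
Proof.
move=> k0 rho0 growth w; rewrite gradE -/J => Tw.
set rhs := 2 * kappa * _.
have [[l Ll hl]|[z [hz hc]]] :=
    multiplier_duality (hess2 g x d - w) (rhs - hess2 f x d 0 0).
  by exists l; split => //; move: hl; rewrite dotvDr dotvNr /hessL; lra.
suff : rhs <= hess2 f x d 0 0 + dotv c z by lra.
exact: (second_order_growth cK (C2_continuous g_C2)
  (fun e => @C2_strict_jacobian _ _ g x e g_C2) rcq_jacobian
  fval_strict fval_second_order
  (fun e => @C2_second_order_jacobian _ _ g x d e g_C2) critical_le0 xS k0 rho0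
  growth Tw hz).
Qed.

End Conditions.

(** For a proximal normal [p] near [d] and a tangent [v], the product is nonpositive, hence |p| <=
    |p - v|. Two triangle inequalities give |d - v| >= |d| - 2 |d - p|; the slack [t] is there
    because the infimum over normals need not be attained. *)
Lemma setdist_Tcone_NPeps (R : realType) (n : nat) (S : set 'rV[R]_n)
    (x d : 'rV[R]_n) (eps : R) : S x -> NPeps S x eps d ->
  (1 - 2 * eps) * eunorm d <= setdist d (Tcone S x).
Proof.
move=> Sx hd; apply: setdist_ge; first by exists 0; exact: Tcone0.
move=> v Tv; apply: (@le_small _ _ _ 2 1) => // t t0 _.
have NP0 : NPcone S x !=set0.
  exists 0; split => //; exists 1; split => // a _.
  by rewrite scaler0 addr0 subrr eunorm0 eunorm_ge0.
have [|p Np dp] := @setdist_near _ _ d (eps * eunorm d + t) _ NP0.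
  by apply: le_lt_trans hd _; rewrite ltrDl.
have pv := NPcone_Tcone_le0 Np Tv.
have pp : eunorm p <= eunorm (p - v).
  apply: ler_of_sqr; first exact: eunorm_ge0.
  rewrite !sqr_eunorm !dotvE (dotvC v p); have := dotvv_ge0 v; lra.
have := eunorm_tri p d v; rewrite (eunormB p d).
have := eunorm_tri d p 0; rewrite !subr0; lra.
Qed.

Theorem theorem3p9 (R : realType) (n m : nat)
  (f : 'rV[R]_n -> 'rV[R]_1) (g : 'rV[R]_n -> 'rV[R]_m) (K : set 'rV[R]_m)
  (xbar : 'rV[R]_n) (kappa delta : R) :
  C2 f -> C2 g -> closed K -> Sol f g K !=set0 ->
  0 < kappa -> 0 < delta ->
  local_sowsm f g K xbar kappa delta ->
  (forall x, Phi g K x -> eball xbar delta x ->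
     forall d, Ccone f g K x d -> DirRCQ g K x d) ->
  (forall (eps : R) (x d : 'rV[R]_n),
     0 <= eps -> eps < 2^-1 ->
     Sol f g K x -> eball xbar delta x ->
     Ccone f g K x d -> NPeps (Sol f g K) x eps d ->
     prop_i f g K x d /\
     prop_ii f g K x d (2 * kappa * (1 - 2 * eps) ^+ 2 * eunorm d ^+ 2)) /\
  (forall x d : 'rV[R]_n,
     Sol f g K x -> eball xbar delta x -> Ccone f g K x d ->
     prop_i f g K x d /\
     prop_ii f g K x d (2 * kappa * setdist d (Tcone (Sol f g K) x) ^+ 2)).
Proof.
move=> f_C2 g_C2 cK _ k0 _ [Pxbar growth] rcq.
have main (x d : 'rV[R]_n) : Sol f g K x -> eball xbar delta x -> Ccone f g K x d ->
     prop_i f g K x d /\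
     prop_ii f g K x d (2 * kappa * setdist d (Tcone (Sol f g K) x) ^+ 2).
  move=> xS xb dC; have dR := rcq x (proj1 xS) xb d dC.
  split; first exact: prop_i_holds.
  (* Growth is re-centred at [x]: the smaller ball lies in the given one, and [x], being optimal,
     has a value no larger than that of [xbar]. *)
  apply: (prop_ii_holds f_C2 g_C2 cK xS dC dR k0 (rho := delta - eunorm (x - xbar))).
    by rewrite subr_gt0.
  move=> x' Px' xx'; apply: le_trans (growth x' Px' _).
    by rewrite lerD2r; case: xS => _; apply.
  rewrite /eball /=; have := eunorm_tri x' x xbar; lra.
split=> // eps x d eps0 eps1 xS xb dC dN; have [h1 h2] := main x d xS xb dC.
split=> // w Tw; have [l [Ll hl]] := h2 w Tw; exists l; split => //.
apply: le_trans hl; rewrite -mulrA -exprMn ler_pM2l; last by rewrite mulr_gt0.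
(* As [eps < 1/2], the lower bound is nonnegative and the inequality between distances may be
   squared. *)
have := setdist_Tcone_NPeps xS dN => hd.
rewrite lerXn2r ?nnegrE //.
  rewrite mulr_ge0 ?eunorm_ge0 //; lra.
apply: le_trans hd; rewrite mulr_ge0 ?eunorm_ge0 //; lra.
Qed.
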